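(* Let $(e^{tA})_{t\ge0}$ be a positive and eventually compact $C_0$-semigroup with generator $A$ on an ordered Banach space $(X,X^+)$. If $u\in X^+$ is an almost interior point and $u'\in(X')^+$ is a strictly positive functional, then $$ s(A)=\omega(A)=\lim_{t\to\infty}\frac{\log\langle u',e^{tA}u\rangle}{t}. $$
   Context: An ordered Banach space $(X,X^+)$ is a real Banach space $X$ together with a closed convex cone $X^+$ (so $X^+ + X^+ \subseteq X^+$ and $[0,\infty)X^+ \subseteq X^+$) with $X^+ \cap (-X^+) = \{0\}$. $(X')^+$ denotes the set of $x'\in X'$ with $\langle x',x\rangle\ge0$ for all $x\in X^+$ (positive functionals). A $C_0$-semigroup $(e^{tA})_{t\ge0}$ is positive if $e^{tA}X^+\subseteq X^+$ for all $t\ge0$, and eventually compact if $e^{tA}$ is compact for some $t\ge0$ (hence for all later times). A vector $u\in X^+$ is an almost interior point of $X^+$ if $\langle x',u\rangle>0$ for every non-zero $x'\in(X')^+$. A functional $u'\in(X')^+$ is strictly positive if $\langle u',x\rangle\neq0$ (equivalently $>0$) for every non-zero $x\in X^+$. The spectral bound is $s(A):=\sup\{\operatorname{Re}\lambda:\lambda\in\sigma(A)\}\in[-\infty,\infty]$ with $\sup\emptyset=-\infty$, where the spectrum is that of the canonical extension of $A$ to a complexification of $X$. The growth bound is $\omega(A):=\inf\{\omega\in\mathbb{R}:\exists M\ge1\ \forall t\ge0\ \|e^{tA}\|\le Me^{t\omega}\}\in[-\infty,\infty)$. Convention: $\log 0=-\infty$. *)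

(* Defs.v *)
From HB Require Import structures.
From mathcomp Require Import all_boot all_order all_algebra.
From mathcomp Require Import all_classical all_reals all_analysis.
From mathcomp Require Import complex.

Set Implicit Arguments.
Unset Strict Implicit.
Unset Printing Implicit Defensive.

Import Order.TTheory GRing.Theory Num.Theory.
Import numFieldNormedType.Exports.

Local Open Scope classical_set_scope.
Local Open Scope ring_scope.

(* [0 \in C] is automatic: [C `&` -C = {0}]. *)
Record ordered_banach_cone (R : realType) (X : completeNormedModType R)
    (C : set X) : Prop := OrderedBanachCone {
  cone_closed : closed C ;
  cone_add : forall x y, C x -> C y -> C (x + y) ;
  cone_scale : forall (a : R) x, 0 <= a -> C x -> C (a *: x) ;
  cone_pointed : C `&` [set - x | x in C] = [set 0]
}.

Definition dual_cone (R : realType) (X : completeNormedModType R)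
    (C : set X) : set {linear X -> R^o} :=
  [set f : {linear X -> R^o} | continuous f /\ forall x, C x -> 0 <= f x].

Definition almost_interior (R : realType) (X : completeNormedModType R)
    (C : set X) (u : X) : Prop :=
  C u /\ forall f : {linear X -> R^o},
    dual_cone C f -> (exists x, f x != 0) -> 0 < f u.

Definition strictly_positive (R : realType) (X : completeNormedModType R)
    (C : set X) (f : {linear X -> R^o}) : Prop :=
  dual_cone C f /\ forall x, C x -> x != 0 -> f x != 0.

(* Only the values [T t] with [0 <= t] are meaningful. *)
Record C0_semigroup (R : realType) (X : completeNormedModType R)
    (T : R -> {linear X -> X}) : Prop := C0Semigroup {
  semigroup_bounded : forall t, 0 <= t -> continuous (T t) ;
  semigroup_0 : forall x, T 0 x = x ;
  semigroup_add : forall s t, 0 <= s -> 0 <= t ->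
    forall x, T (s + t) x = T s (T t x) ;
  semigroup_strongly_continuous : forall x, T t x @[t --> 0^'+] --> x
}.

Definition positive_semigroup (R : realType) (X : completeNormedModType R)
    (C : set X) (T : R -> {linear X -> X}) : Prop :=
  forall t, 0 <= t -> T t @` C `<=` C.

Definition compact_operator (R : realType) (X Y : completeNormedModType R)
    (f : {linear X -> Y}) : Prop :=
  precompact (f @` [set x | `|x| <= 1]).

Definition eventually_compact (R : realType) (X : completeNormedModType R)
    (T : R -> {linear X -> X}) : Prop :=
  exists t, 0 <= t /\ compact_operator (T t).

(* The values of [uop] outside [udom] are irrelevant. *)
Record unbounded_operator (E : Type) := UnboundedOperator {
  udom : set E ;
  uop : E -> E
}.

Definition generator (R : realType) (X : completeNormedModType R)
    (T : R -> {linear X -> X}) : unbounded_operator X :=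
  {| udom := [set x | cvg (h^-1 *: (T h x - x) @[h --> 0^'+])] ;
     uop := fun x => lim (h^-1 *: (T h x - x) @[h --> 0^'+]) |}.

(* The complexification [X + iX], as pairs (real part, imaginary part).  Every
   norm customarily put on it is equivalent to the max norm of [X * X], so that
   only the product topology is needed to speak about the spectrum. *)
Definition complexification (R : realType) (X : completeNormedModType R) : Type :=
  (X * X)%type.

Section Complexification.
Variables (R : realType) (X : completeNormedModType R).
Local Notation XC := (complexification X).

HB.instance Definition _ := GRing.Zmodule.copy XC (X * X)%type.
HB.instance Definition _ := Uniform.copy XC (X * X)%type.

Definition complex_scale (l : R[i]) (z : XC) : XC :=
  (complex.Re l *: z.1 - complex.Im l *: z.2,
   complex.Im l *: z.1 + complex.Re l *: z.2).

Let complex_scaleA (a b : R[i]) (z : XC) :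
  complex_scale a (complex_scale b z) = complex_scale (a * b) z.
Proof.
case: a b z => [a a'] [b b'] [x y]; rewrite /complex_scale /=.
congr pair; rewrite !(scalerBr, scalerDr, scalerDl, scaleNr, scalerA) ?opprD.
  exact: addrACA.
by rewrite addrC addrACA.
Qed.

Let complex_scale1 : left_id 1 complex_scale.
Proof.
by case=> x y; rewrite /complex_scale /= !scale1r !scale0r subr0 add0r.
Qed.

Let complex_scaleDr : right_distributive complex_scale +%R.
Proof.
case=> a b [x y] [x' y']; congr pair => /=; rewrite !scalerDr ?opprD;
  exact: addrACA.
Qed.

Let complex_scaleDl (z : XC) : {morph complex_scale^~ z : a b / a + b}.
Proof.
case: z => x y [a a'] [b b']; congr pair => /=; rewrite !scalerDl ?opprD;
  exact: addrACA.
Qed.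

HB.instance Definition _ := GRing.Zmodule_isLmodule.Build R[i] XC
  complex_scaleA complex_scale1 complex_scaleDr complex_scaleDl.

Definition complexified_operator (A : unbounded_operator X) :
    unbounded_operator XC :=
  {| udom := [set z | udom A z.1 /\ udom A z.2] ;
     uop := fun z => (uop A z.1, uop A z.2) |}.

End Complexification.

Definition resolvent_set (K : numFieldType) (E : preTopologicalLmodType K)
    (A : unbounded_operator E) : set K :=
  [set l | exists S : E -> E, [/\ continuous S,
     (forall y, udom A (S y) /\ l *: S y - uop A (S y) = y) &
     (forall x, udom A x -> S (l *: x - uop A x) = x)]].

Definition spectrum (K : numFieldType) (E : preTopologicalLmodType K)
    (A : unbounded_operator E) : set K :=
  ~` resolvent_set A.

Definition spectral_bound (R : realType) (X : completeNormedModType R)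
    (A : unbounded_operator X) : \bar R :=
  ereal_sup [set (complex.Re l)%:E | l in spectrum (complexified_operator A)].

Definition operator_norm (R : realType) (X Y : completeNormedModType R)
    (f : {linear X -> Y}) : \bar R :=
  ereal_sup [set `|f x|%:E | x in [set x | `|x| <= 1]].

Definition growth_bound (R : realType) (X : completeNormedModType R)
    (T : R -> {linear X -> X}) : \bar R :=
  ereal_inf [set w%:E | w in [set w : R | exists M : R, 1 <= M /\
    forall t, 0 <= t -> (operator_norm (T t) <= (M * expR (t * w))%:E)%E]].

(* Main.v *)
Require Import Defs.
From HB Require Import structures.
From mathcomp Require Import all_boot all_order all_algebra.
From mathcomp Require Import all_classical all_reals all_analysis.
From mathcomp Require Import complex ring lra.

Set Implicit Arguments.
Unset Strict Implicit.
Unset Printing Implicit Defensive.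

Import Order.TTheory GRing.Theory Num.Theory.
Import numFieldNormedType.Exports.

Local Open Scope classical_set_scope.
Local Open Scope ring_scope.

(** Let [w] be the growth bound and [f t = u' (T t u)].  The inequality [f t <=
    K exp (t (w + e))] is immediate, and [s(A) <= w] holds because the Laplace
    transform of [exp (- t l) T t] inverts [l - A] when [w < Re l]; the transform
    is built as a limit of Riemann sums, each of which is a Neumann series
    ([laplace_resolvent], [growth_rate_resolvent]).  If [w = -oo], nothing else is
    to be proved.  Otherwise the semigroup is multiplied by [exp (- t w)], so that
    [w = 0], and [G] denotes one of its compact members.  The powers of [G] grow
    more slowly than any exponential but have norm at least 1.

    The hypotheses on [u] and [u'] enter through two estimates for [G].  Since [u]
    is almost interior, the cone [R+ u - C] is dense (Hahn-Banach), and by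
    compactness every [G y] is dominated by a multiple of [u], up to an error of
    norm [|y| / 2], the multiple being controlled by [|y|]
    ([compact_order_bound]).  Since [u'] is strictly positive, compactness gives
    [|G x| <= N u' (G x) + d |x|] on [C], with [d] as small as desired
    ([compact_strictly_positive_bound]).  Iterating them shows that [u' (G^m u)]
    cannot tend to 0, since [|G^m|] would then tend to 0
    ([orbit_decay_norm_decay]).

    This yields [w <= s(A)].  As [l] decreases to 1, the vectors
    [y = sum_k l^-k G^k u] are unbounded, because a limit would make
    [sum_k u' (G^k u)] converge; normalised, they converge to a positive fixed
    vector of [G] ([krein_rutman]).  Averages of its orbit under the semigroup
    converge to a vector fixed by the whole semigroup
    ([semigroup_fixed_vector]), and [A] has the eigenvalue [w].

    The lower bound for [f] must hold at all large times, not only along a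
    sequence, and here norms of orbits have to be compared at consecutive times.
    The moduli of the complex eigenvalues of [G] do not accumulate in [(0, 1]]
    ([exists_radius_without_eigenplane]), so some [rho < 1] arbitrarily close to 1
    is not such a modulus, and then [G - z] is bounded below uniformly for
    [|z| = rho].  A discrete Fourier transform turns this into
    [|G^l x| / rho^l <= M (|x| + |G^n x| / rho^n)] for [l < n]
    ([orbit_dichotomy]).  The orbit of [u] outgrows [rho^n]; by the last
    inequality it does so from some time on, and [|G^(n+1) u| >= c |G^n u|] for
    large [n] ([outgrowing_orbit_regular]).  Hence the error term in the estimate
    for [u'] is absorbed, and [u' (T t u)] is comparable to [|T t u|]
    ([pairing_lower_bound]). *)

(** * Identities between linear combinations *)

(** Syntax of linear combinations: an identity between vectors follows from
    identities between scalars, one for each atom. *)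
Inductive lincomb (R : Type) :=
  LAtom of nat | LZero | LAdd of lincomb R & lincomb R | LOpp of lincomb R
| LScale of R & lincomb R.
Arguments LAtom {R}. Arguments LZero {R}.

Fixpoint nat_eqb (i j : nat) : bool :=
  match i, j with
  | 0%N, 0%N => true
  | i'.+1, j'.+1 => nat_eqb i' j'
  | _, _ => false
  end.

Lemma nat_eqbE i j : nat_eqb i j = (i == j).
Proof. by elim: i j => [|i IH] [|j] //=. Qed.

Section LinComb.
Context {R : pzRingType} {V : lmodType R}.

Fixpoint lincomb_eval (env : seq V) (e : lincomb R) : V :=
  match e with
  | LAtom i => nth 0 env i
  | LZero => 0
  | LAdd a b => lincomb_eval env a + lincomb_eval env b
  | LOpp a => - lincomb_eval env a
  | LScale r a => r *: lincomb_eval env a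
  end.

Fixpoint lincomb_coef (e : lincomb R) (i : nat) : R :=
  match e with
  | LAtom j => if nat_eqb i j then 1 else 0
  | LZero => 0
  | LAdd a b => lincomb_coef a i + lincomb_coef b i
  | LOpp a => - lincomb_coef a i
  | LScale r a => r * lincomb_coef a i
  end.

Fixpoint conj_below (P : nat -> Prop) n : Prop :=
  if n is m.+1 then P m /\ conj_below P m else True.

Lemma lincomb_evalE env e :
  lincomb_eval env e = \sum_(i < size env) lincomb_coef e i *: env`_i.
Proof.
elim: e => /= [j||a -> b ->|a ->|r a ->].
- have [js|js] := ltnP j (size env).
    rewrite (bigD1 (Ordinal js))// nat_eqbE eqxx scale1r big1 /= ?addr0// => i.
    by rewrite -val_eqE nat_eqbE => /negbTE ->; rewrite scale0r.
  rewrite nth_default// big1// => i _.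
  by rewrite nat_eqbE ltn_eqF ?scale0r// (leq_trans (ltn_ord i)).
- by rewrite big1// => i _; rewrite scale0r.
- by rewrite -big_split/=; apply: eq_bigr => i _; rewrite scalerDl.
- by rewrite -sumrN; apply: eq_bigr => i _; rewrite scaleNr.
- by rewrite scaler_sumr; apply: eq_bigr => i _; rewrite scalerA.
Qed.

Lemma lincomb_eq env a b :
  conj_below (fun i => lincomb_coef a i = lincomb_coef b i) (size env) ->
  lincomb_eval env a = lincomb_eval env b.
Proof.
move=> ab; rewrite !lincomb_evalE; apply: eq_bigr => i _; congr (_ *: _).
elim: (size env) i ab => [[]//|n IH] i /= [an ab].
have [e|ni] := eqVneq (i : nat) n; first by rewrite e.
have i_n : (i < n)%N by rewrite ltn_neqAle ni -ltnS ltn_ord.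
exact: (IH (Ordinal i_n)).
Qed.

End LinComb.

Ltac lc_index x env :=
  match env with
  | x :: _ => constr:(0%N)
  | _ :: ?t => let k := lc_index x t in constr:(k.+1)
  end.

Ltac lc_mem x env :=
  match env with
  | x :: _ => constr:(true)
  | _ :: ?t => lc_mem x t
  | _ => constr:(false)
  end.

Ltac lc_atoms R e env :=
  match e with
  | (?a + ?b)%R => let env1 := lc_atoms R a env in lc_atoms R b env1
  | (- ?a)%R => lc_atoms R a env
  | (?r *: ?a)%R => lc_atoms R a env
  | 0%R => env
  | _ => match lc_mem e env with true => env | false => constr:(e :: env) end
  end.

Ltac lc_reify R e env :=
  match e with
  | (?a + ?b)%R => let a' := lc_reify R a env in let b' := lc_reify R b env in
                   constr:(LAdd a' b')
  | (- ?a)%R => let a' := lc_reify R a env in constr:(LOpp a')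
  | (?r *: ?a)%R => let a' := lc_reify R a env in constr:(@LScale R r a')
  | 0%R => constr:(@LZero R)
  | _ => let k := lc_index e env in constr:(@LAtom R k)
  end.

Ltac module_eq R V :=
  match goal with |- ?a = ?b =>
    let env0 := lc_atoms R a (@nil V) in
    let env := lc_atoms R b env0 in
    let a' := lc_reify R a env in
    let b' := lc_reify R b env in
    apply: (@lincomb_eq _ V env a' b'); cbn [conj_below lincomb_coef size nat_eqb]; repeat split
  end.

(** * Compactness along an ultrafilter *)

(** An ultrafilter contains every neighbourhood of its cluster points. A single
    ultrafilter on the indices serves several sequences at once, without
    successive extractions of subsequences. *)
Lemma compact_ultra_cvg (T : topologicalType) (I : Type) (U : set_system I)
    (f : I -> T) (K : set T) :
  UltraFilter U -> compact K -> (forall i, K (f i)) ->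
  exists l, K l /\ f i @[i --> U] --> l.
Proof.
move=> UU cK Kf.
have FK : (f @ U) K by rewrite /= nbhs_filterE; near=> i; exact: Kf.
have [l [Kl cl]] := cK _ _ FK.
exists l; split=> // B lB.
have [//|UB] := in_ultra_setVsetC (f @^-1` B) UU.
by have [y []] := cl (~` B) B UB lB.
Unshelve. all: by end_near. Qed.

Lemma bounded_ultra_cvg (R : realType) (I : Type) (U : set_system I)
    (f : I -> R) (a b : R) :
  UltraFilter U -> (forall i, a <= f i <= b) ->
  exists l, a <= l <= b /\ f i @[i --> U] --> l.
Proof.
move=> UU fab.
have [l []] := compact_ultra_cvg UU (@segment_compact R a b) fab.
by rewrite /= in_itv /= => lab fl; exists l.
Qed.

Lemma compact_operator_ultra_cvg (R : realType) (X Y : completeNormedModType R)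
    (G : {linear X -> Y}) (I : Type) (U : set_system I) (x : I -> X) (B : R) :
  UltraFilter U -> compact_operator G -> (forall i, `|x i| <= B) ->
  exists l : Y, (fun i => G (x i)) @ U --> l.
Proof.
move=> UU; rewrite /compact_operator precompactE => cG xB.
have [i0 _] : exists i0 : I, True.
  by have [i _] := @filter_ex _ U _ setT filterT; exists i.
pose b := B + 1.
have b0 : 0 < b by rewrite ltr_wpDl// (le_trans _ (xB i0)).
have KG i : closure (G @` [set x | `|x| <= 1]) (G (b^-1 *: x i)).
  apply: subset_closure; exists (b^-1 *: x i) => //=.
  rewrite normrZ gtr0_norm ?invr_gt0// ler_pdivrMl// mulr1.
  by rewrite (le_trans (xB i))// lerDl.
have [l [_ Gl]] := compact_ultra_cvg UU cG KG.
exists (b *: l).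
have -> : (fun i => G (x i)) = (fun i => b *: G (b^-1 *: x i)).
  by apply/funext => i; rewrite linearZ scalerA divff ?scale1r// gt_eqF.
exact: cvgZr.
Qed.

Lemma ultra_eventually : exists U : set_system nat,
  UltraFilter U /\ \oo `<=` U.
Proof. exact: ultraFilterLemma. Qed.

Lemma continuous_linear_bound (R : realType) (X Y : normedModType R)
    (f : {linear X -> Y}) :
  continuous f -> exists M, 0 < M /\ forall x, `|f x| <= M * `|x|.
Proof.
move=> /(_ 0)/continuous_linear_bounded/linear_boundedP [M [_ Mf]].
exists (Num.max 1 (M + 1)); split; first by rewrite lt_max ltr01.
by move=> x; apply: Mf; rewrite lt_max ltrDl ltr01 orbT.
Qed.

(** * Hahn-Banach through minimal sublinear functionals *)

Section HahnBanach.
Context {R : realType} {V : lmodType R}.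

Definition sublinear (p : V -> R) :=
  (forall x y, p (x + y) <= p x + p y) /\
  (forall a x, 0 < a -> p (a *: x) <= a * p x).

Lemma sublinear0 p : sublinear p -> p 0 = 0.
Proof.
move=> [pD pZ]; apply/eqP; rewrite eq_le; apply/andP; split.
  have := pZ (2^-1) 0 ltac:(by rewrite invr_gt0); rewrite scaler0 => h.
  lra.
by have := pD 0 0; rewrite addr0; lra.
Qed.

Lemma sublinearZ p a x : sublinear p -> 0 <= a -> p (a *: x) = a * p x.
Proof.
move=> sp; have p0 := sublinear0 sp; case: sp => pD pZ.
rewrite le_eqVlt => /orP[/eqP <-|a0]; first by rewrite scale0r p0 mul0r.
apply/eqP; rewrite eq_le pZ//= -ler_pdivlMl//.
rewrite -{1}[x](scalerK (lt0r_neq0 a0)).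
by apply: pZ; rewrite invr_gt0.
Qed.

Lemma sublinearN p x : sublinear p -> - p (- x) <= p x.
Proof.
move=> sp; have p0 := sublinear0 sp; case: sp => pD _.
by have := pD x (- x); rewrite subrr p0; lra.
Qed.

(** A sublinear minorant of [q] that reads off the growth of [q] along the ray
    through [y]; a minimal [q] has to coincide with it. *)
Definition ray_minorant (q : V -> R) (y x : V) : R :=
  inf [set q (x + t *: y) - t * q y | t in [set t | 0 <= t]].

Lemma ray_minorant_has_inf q x y : sublinear q ->
  has_inf [set q (x + t *: y) - t * q y | t in [set t | 0 <= t]].
Proof.
move=> sq; split; first by exists (q (x + 0 *: y) - 0 * q y), 0 => /=.
exists (- q (- x)) => _ [t /= t0 <-].
have := sq.1 (x + t *: y) (- x).
by rewrite addrAC subrr add0r (sublinearZ _ sq)//; lra.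
Qed.

Lemma ray_minorantE q x y t : sublinear q -> 0 <= t ->
  ray_minorant q y x <= q (x + t *: y) - t * q y.
Proof.
move=> sq t0; apply: ge_inf; first exact: (ray_minorant_has_inf _ _ sq).2.
by exists t.
Qed.

Lemma ray_minorant_le q y x : sublinear q -> ray_minorant q y x <= q x.
Proof.
move=> sq; have := ray_minorantE x y sq (lexx 0).
by rewrite scale0r addr0 mul0r subr0.
Qed.

Lemma ray_minorant_sublinear q y : sublinear q -> sublinear (ray_minorant q y).
Proof.
move=> sq; split=> [x z|a x a0].
  rewrite -lerBlDr; apply: lb_le_inf; first exact: (ray_minorant_has_inf _ _ sq).1.
  move=> _ [t /= t0 <-]; rewrite lerBlDr -lerBlDl.
  apply: lb_le_inf; first exact: (ray_minorant_has_inf _ _ sq).1.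
  move=> _ [s /= s0 <-]; rewrite lerBlDl.
  apply: (le_trans (ray_minorantE _ y sq (addr_ge0 t0 s0))).
  by have := sq.1 (x + t *: y) (z + s *: y); rewrite scalerDl addrACA; lra.
rewrite -ler_pdivrMl//; apply: lb_le_inf.
  exact: (ray_minorant_has_inf _ _ sq).1.
move=> _ [t /= t0 <-]; rewrite ler_pdivrMl//.
apply: (le_trans (ray_minorantE _ y sq (mulr_ge0 (ltW a0) t0))).
by rewrite -scalerA -scalerDr (sublinearZ _ sq (ltW a0)) mulrBr mulrA.
Qed.

(** Minimality makes [ray_minorant q y] equal to [q]; its definition at [t = 1]
    then gives the missing half of additivity. *)
Lemma minimal_sublinear_linear q : sublinear q ->
  (forall r, sublinear r -> (forall x, r x <= q x) -> r = q) ->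
  linear q.
Proof.
move=> sq qmin.
have qD x y : q (x + y) = q x + q y.
  apply/eqP; rewrite eq_le sq.1/=.
  have qy : ray_minorant q y = q.
    apply: qmin; first exact: ray_minorant_sublinear.
    by move=> z; exact: ray_minorant_le.
  have := ray_minorantE x y sq ler01.
  by rewrite scale1r mul1r qy; lra.
have qN x : q (- x) = - q x.
  by have := qD x (- x); rewrite subrr (sublinear0 sq); lra.
move=> a x y; rewrite qD; congr (_ + _).
have [a0|a0] := leP 0 a; first exact: sublinearZ.
have Na0 : 0 <= - a by rewrite oppr_ge0 ltW.
by rewrite -[a]opprK scaleNr qN (sublinearZ _ sq Na0) -mulNr.
Qed.

(** Zorn's lemma. The infimum of a chain of sublinear minorants is finite, since
    each of them is at least [- p (- x)] at [x], and subadditive, since of two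
    members of the chain one lies below the other. *)
Lemma exists_linear_minorant p : sublinear p ->
  exists f : V -> R, linear f /\ forall x, f x <= p x.
Proof.
move=> sp.
pose S := {q : V -> R | sublinear q /\ forall x, q x <= p x}.
pose ord (q r : S) : bool := `[< forall x, sval r x <= sval q x >].
have [] := @Zorn S ord.
- by move=> q; apply/asboolP.
- move=> q r s /asboolP rq /asboolP sr; apply/asboolP => x.
  exact: le_trans (rq x).
- move=> [q sq] [r sr] /asboolP /= rq /asboolP /= qr.
  apply: eq_exist; apply/funext => x; apply/eqP.
  by rewrite eq_le qr rq.
- move=> A totA; have [[q0 Aq0]|A0] := pselect (A !=set0); last first.
    by exists (exist _ p (conj sp (fun x => lexx _))) => q Aq; case: A0; exists q.
  have infx x : has_inf [set sval q x | q in A].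
    split; first by exists (sval q0 x), q0.
    exists (- p (- x)) => _ [q Aq <-].
    by case: (svalP q) => sq /(_ (- x)); have := sublinearN x sq; lra.
  have infle q x : A q -> inf [set sval r x | r in A] <= sval q x.
    by move=> Aq; apply: ge_inf; [exact: (infx x).2|exists q].
  pose m x := inf [set sval q x | q in A].
  have sm : sublinear m.
    split=> [x y|a x a0].
      rewrite -lerBlDr; apply: lb_le_inf; first exact: (infx x).1.
      move=> _ [q Aq <-]; rewrite lerBlDr -lerBlDl.
      apply: lb_le_inf; first exact: (infx y).1.
      move=> _ [r Ar <-]; rewrite lerBlDl.
      have [/asboolP rq|/asboolP qr] := totA q r Aq Ar.
        apply: (le_trans (infle _ _ Ar)); apply: (le_trans ((svalP r).1.1 x y)).
        by rewrite lerD2r.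
      apply: (le_trans (infle _ _ Aq)); apply: (le_trans ((svalP q).1.1 x y)).
      by rewrite lerD2l.
    rewrite -ler_pdivrMl//; apply: lb_le_inf; first exact: (infx x).1.
    move=> _ [q Aq <-]; rewrite ler_pdivrMl//.
    exact: le_trans (infle _ _ Aq) ((svalP q).1.2 a x a0).
  have mp x : m x <= p x := le_trans (infle _ _ Aq0) ((svalP q0).2 x).
  exists (exist _ m (conj sm mp)) => q Aq; apply/asboolP => x /=.
  exact: infle.
move=> [q [sq qp]] qmax; exists q; split=> //.
apply: minimal_sublinear_linear => // r sr rq.
have rp x : r x <= p x := le_trans (rq x) (qp x).
have := qmax (exist _ r (conj sr rp)) ltac:(exact/asboolP).
by move=> /(congr1 sval).
Qed.

(** The ray minorant of [p] along [y] takes at [- y] a value that is at most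
    [- p y], which forces [p y <= f y]. *)
Lemma exists_linear_minorant_at p y : sublinear p ->
  exists f : V -> R, [/\ linear f, forall x, f x <= p x & f y = p y].
Proof.
move=> sp; have [f [lf fp]] := exists_linear_minorant (ray_minorant_sublinear y sp).
exists f; split=> //.
  by move=> x; apply: le_trans (fp x) (ray_minorant_le _ _ sp).
have f0 : f 0 = 0 by have := lf (-1) 0 0; rewrite scaler0 addr0 scaleN1r addNr.
have := ray_minorantE (- y) y sp ler01; rewrite scale1r mul1r addNr (sublinear0 sp).
have := fp (- y); have := le_trans (fp y) (ray_minorant_le y y sp).
have := lf (-1) y 0; rewrite f0 !addr0 !scaleN1r => ->; lra.
Qed.

End HahnBanach.

(** * Compact operators in an ordered Banach space *)

Lemma linear_bound_continuous (R : realType) (X Y : normedModType R)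
    (f : {linear X -> Y}) (M : R) :
  (forall x, `|f x| <= M * `|x|) -> continuous f.
Proof.
move=> fM; apply/bounded_linear_continuous/linear_boundedP.
near=> r => x; apply: le_trans (fM x) _; rewrite ler_wpM2r//.
Unshelve. all: by end_near. Qed.

Section Cone.
Context {R : realType} {X : completeNormedModType R} (C : set X).
Hypothesis hC : ordered_banach_cone C.

Lemma cone0 : C 0.
Proof.
have : (C `&` [set - x | x in C]) 0 by rewrite (cone_pointed hC).
by case.
Qed.

(** Otherwise the distance to the convex cone [R+ u - C] is a sublinear
    functional that does not vanish at [y]. A linear functional below it with
    the same value at [y] is nonpositive on that cone: it is a nonzero positive
    functional that is not positive at [u]. *)
Lemma order_ideal_dense u y (e : R) : almost_interior C u -> 0 < e ->
  exists a c, [/\ 0 <= a, C c & `|y - (a *: u - c)| < e].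
Proof.
move=> [_ ui] e0; apply: contrapT => far.
pose D := [set d | exists a c, [/\ 0 <= a, C c & d = a *: u - c]].
have D0 : D 0 by exists 0, 0; split; rewrite ?scale0r ?subr0//; exact: cone0.
have DD d1 d2 : D d1 -> D d2 -> D (d1 + d2).
  move=> [a [c [a0 Cc ->]]] [b [c' [b0 Cc' ->]]]; exists (a + b), (c + c').
  split; [exact: addr_ge0|exact: cone_add|].
  by rewrite scalerDl opprD addrACA.
have DZ t d : 0 <= t -> D d -> D (t *: d).
  move=> t0 [a [c [a0 Cc ->]]]; exists (t * a), (t *: c).
  by split; [exact: mulr_ge0|exact: cone_scale|rewrite scalerBr scalerA].
pose p x : R := inf [set `|x - d| | d in D].
have hp x : has_inf [set `|x - d| | d in D].
  by split; [exists `|x - 0|, 0|exists 0 => _ [d _ <-]].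
have pD x d : D d -> p x <= `|x - d|.
  by move=> Dd; apply: ge_inf; [exact: (hp x).2|exists d].
have sp : sublinear p.
  split=> [x z|t x t0].
    rewrite -lerBlDr; apply: lb_le_inf; first exact: (hp x).1.
    move=> _ [d Dd <-]; rewrite lerBlDr -lerBlDl.
    apply: lb_le_inf; first exact: (hp z).1.
    move=> _ [d' Dd' <-]; rewrite lerBlDl.
    apply: le_trans (pD _ _ (DD _ _ Dd Dd')) _.
    by rewrite opprD addrACA ler_normD.
  rewrite -ler_pdivrMl//; apply: lb_le_inf; first exact: (hp x).1.
  move=> _ [d Dd <-]; rewrite ler_pdivrMl//.
  apply: le_trans (pD _ _ (DZ _ _ (ltW t0) Dd)) _.
  by rewrite -scalerBr normrZ gtr0_norm.
have py : e <= p y.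
  apply: lb_le_inf; first exact: (hp y).1.
  move=> _ [d [a [c [a0 Cc ->]]] <-]; rewrite leNgt; apply/negP => lt.
  by apply: far; exists a, c.
have [f [lf fp fy]] := exists_linear_minorant_at y sp.
pose F : {linear X -> R^o} := HB.pack f (GRing.isLinear.Build R X R^o *:%R f lf).
have FD d : D d -> F d <= 0.
  by move=> Dd; apply: le_trans (fp d) _; have := pD d d Dd; rewrite subrr normr0.
have Fn x : F x <= `|x|.
  by apply: le_trans (fp x) _; have := pD x 0 D0; rewrite subr0.
have dF : dual_cone C F.
  split.
    apply: (@linear_bound_continuous _ _ _ F 1) => x; rewrite mul1r ler_norml Fn andbT.
    by have := Fn (- x); rewrite normrN linearN; lra.
  move=> x Cx; have /FD : D (- x).
    by exists 0, x; split; rewrite ?scale0r ?add0r.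
  by rewrite linearN; lra.
have Fy : F y != 0 by rewrite gt_eqF// (lt_le_trans e0)//= -[X in _ <= X]/(f y) fy.
have := ui F dF ltac:(by exists y); rewrite ltNge FD//.
by exists 1, 0; split; rewrite ?subr0 ?scale1r//; exact: cone0.
Qed.

Section CompactPositive.
Variables (G : {linear X -> X}).
Hypotheses (cG : compact_operator G) (ctG : continuous G).
Hypothesis posG : forall x, C x -> C (G x).

(** The density of [R+ u - C] becomes uniform on the relatively compact image of
    the unit ball. The coefficient [2^-1] is what makes the iteration of this
    bound contract. *)
Lemma compact_order_bound u : almost_interior C u ->
  exists N : R, 0 < N /\ forall y, exists a c,
    [/\ 0 <= a <= N * `|y|, C c & `|G y - (a *: u - c)| <= 2^-1 * `|y|].
Proof.
move=> hu; apply: contrapT => no.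
have : forall n : nat, exists y, `|y| = 1 /\ forall a c, 0 <= a <= n.+1%:R ->
    C c -> 2^-1 < `|G y - (a *: u - c)|.
  move=> n; apply: contrapT => nP; apply: no; exists n.+1%:R; split=> // y.
  apply: contrapT => yP; apply: nP.
  have [y0|y0] := eqVneq y 0.
    exfalso; apply: yP; exists 0, 0; rewrite y0 normr0 !mulr0 lexx linear0.
    by rewrite scale0r !subr0 normr0; split=> //; exact: cone0.
  have ny : 0 < `|y| by rewrite normr_gt0.
  exists (`|y|^-1 *: y); split; first by rewrite normrZ normfV normr_id mulVf ?gt_eqF.
  move=> a c /andP[a0 an] Cc; rewrite ltNge; apply/negP => le; apply: yP.
  exists (`|y| * a), (`|y| *: c); split.
  - by rewrite mulr_ge0//= [leRHS]mulrC ler_wpM2l.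
  - exact: cone_scale.
  - rewrite -scalerA -scalerBr -{1}[y](scalerKV (lt0r_neq0 ny)) linearZ/= -scalerBr.
    by rewrite normrZ normr_id [leRHS]mulrC ler_wpM2l.
move=> /choice[y yP]; have [U [UU Uoo]] := ultra_eventually.
have yB n : `|y n| <= 1 by rewrite (yP n).1.
have [z zl] := compact_operator_ultra_cvg UU cG yB.
have [a [c [a0 Cc ac]]] := @order_ideal_dense u z (4^-1) hu ltac:(by rewrite invr_gt0).
have e4 : 0 < (4^-1 : R) by rewrite invr_gt0.
have /cvgrPdist_lt/(_ _ e4) n1 := zl.
have n2 : \forall n \near U, a <= n.+1%:R.
  apply: Uoo; near=> n; apply: ltW; apply: lt_le_trans (_ : n%:R <= _); last by rewrite ler_nat.
  near: n; exact: nbhs_infty_gtr.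
have [n [n1' n2']] := filter_ex (filterI n1 n2).
have := (yP n).2 a c; rewrite a0 n2' => /(_ isT Cc).
have := ler_distD z (G (y n)) (a *: u - c); rewrite distrC in n1'.
lra.
Unshelve. all: by end_near. Qed.

(** A strictly positive functional need not be bounded below on the unit sphere
    of the cone, but it is on compact sets of nonzero positive vectors; the term
    in [d] takes care of the unit vectors with a small image. *)
Lemma compact_strictly_positive_bound u' (d : R) : strictly_positive C u' -> 0 < d ->
  exists N : R, 0 < N /\ forall x, C x -> `|G x| <= N * u' (G x) + d * `|x|.
Proof.
move=> [[cu u'C] u's] d0; apply: contrapT => no.
have : forall n : nat, exists x, [/\ C x, `|x| = 1 &
    n.+1%:R * u' (G x) + d < `|G x|].
  move=> n; apply: contrapT => nP; apply: no; exists n.+1%:R; split=> // x Cx.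
  rewrite leNgt; apply/negP => lt; apply: nP.
  have [x0|x0] := eqVneq x 0.
    by move: lt; rewrite x0 !(linear0, normr0) !mulr0 addr0 ltxx.
  have ny : 0 < `|x| by rewrite normr_gt0.
  exists (`|x|^-1 *: x); split.
  - by apply: cone_scale => //; rewrite invr_ge0 ltW.
  - by rewrite normrZ normfV normr_id mulVf ?gt_eqF.
  - rewrite !linearZ/= normrZ normfV normr_id -[`|x|^-1 *: _]/(`|x|^-1 * _).
    by rewrite ltr_pdivlMl// mulrDr mulrCA mulVKf ?gt_eqF// [_ * d]mulrC.
move=> /choice[x xP]; have [U [UU Uoo]] := ultra_eventually.
have xB n : `|x n| <= 1 by have [_ -> _] := xP n.
have [z zl] := compact_operator_ultra_cvg UU cG xB.
have Cz : C z.
  apply: (closed_cvg C (cone_closed hC) _ _ zl).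
  by near=> n; apply: posG; have [] := xP n.
have dz : d <= `|z|.
  have nl : `|G (x n)| @[n --> U] --> `|z| by apply: cvg_norm.
  apply: (closed_cvg (fun r => d <= r) _ _ _ nl); first exact: closed_ge.
  near=> n; have [Cx _ /ltW] := xP n; apply: le_trans.
  by rewrite lerDr mulr_ge0//; apply: u'C; exact: posG.
have z0 : z != 0 by rewrite -normr_gt0 (lt_le_trans d0).
have uz : 0 < u' z by rewrite lt_neqAle eq_sym u's// u'C.
have [M [M0 GM]] := continuous_linear_bound ctG.
have n1 : \forall n \near U, u' z / 2 < u' (G (x n)).
  have : u' (G (x n)) @[n --> U] --> u' z by apply: continuous_cvg => //; exact: cu.
  move=> /cvgr_gt; apply; lra.
have n2 : \forall n \near U, 2 * M / u' z <= n.+1%:R.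
  apply: Uoo; near=> n; apply: ltW; apply: lt_le_trans (_ : n%:R <= _); last by rewrite ler_nat.
  near: n; exact: nbhs_infty_gtr.
have [n [n1' n2']] := filter_ex (filterI n1 n2).
have [Cx nx] := xP n; have := GM (x n); rewrite nx mulr1.
have : 2 * M / u' z * (u' z / 2) <= n.+1%:R * u' (G (x n)).
  apply: ler_pM => //; last exact: ltW.
    by rewrite !mulr_ge0// ?invr_ge0 ltW.
  by apply: divr_ge0 => //; exact: ltW.
have -> : 2 * M / u' z * (u' z / 2) = M by field; rewrite gt_eqF.
lra.
Unshelve. all: by end_near. Qed.

End CompactPositive.
End Cone.

(** * Decay of one positive orbit forces decay in norm *)

Section Iterate.
Context {R : realType} {X : lmodType R} (G : {linear X -> X}).

Lemma iter_linearB m x y : iter m G (x - y) = iter m G x - iter m G y.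
Proof. by elim: m => //= m ->; rewrite linearB. Qed.

Lemma iter_linearD m x y : iter m G (x + y) = iter m G x + iter m G y.
Proof. by elim: m => //= m ->; rewrite linearD. Qed.

Lemma iter_linearZ m a x : iter m G (a *: x) = a *: iter m G x.
Proof. by elim: m => //= m ->; rewrite linearZ. Qed.

End Iterate.

(** Up to an error tending to 0, each step halves [b]. *)
Lemma halving_recursion_cvg0 (R : realType) (N : R) (e b : nat -> R) :
  (forall m, b m.+1 = N * e m + 2^-1 * b m) -> e @ \oo --> 0 -> b @ \oo --> 0.
Proof.
move=> bS e0; apply/cvgr0Pnorm_le => eps eps0.
(* each step adds at most [eps / 4] to half of the previous term *)
pose eta := eps / (4 * (`|N| + 1)).
have N1 : 0 < `|N| + 1 by rewrite ltr_wpDl.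
have eta0 : 0 < eta by rewrite divr_gt0// mulr_gt0.
have Neta : `|N| * eta <= eps / 4.
  rewrite /eta -[leRHS](_ : (`|N| + 1) * (eps / (4 * (`|N| + 1))) = _).
    by rewrite ler_wpM2r ?lerDl// ltW.
  by field; rewrite gt_eqF.
have [M _ MP] := (cvgr0Pnorm_le _).1 e0 _ eta0.
have bk k : `|b (M + k)%N| <= `|b M| * 2^-1 ^+ k + eps / 2.
  elim: k => [|k IH]; first by rewrite addn0 expr0 mulr1 lerDl divr_ge0 ?ltW.
  rewrite addnS bS; apply: le_trans (ler_normD _ _) _; rewrite !normrM.
  have -> : `|2^-1 : R| = 2^-1 by rewrite ger0_norm.
  have : `|N| * `|e (M + k)%N| <= eps / 4.
    by apply: le_trans Neta; rewrite ler_wpM2l// MP//= leq_addr.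
  move: IH; rewrite exprS; set t := `|b M|; set w := _ ^+ k.
  have -> : t * (2^-1 * w) = 2^-1 * (t * w) by rewrite mulrCA.
  lra.
have : `|b M| * 2^-1 ^+ k @[k --> \oo] --> `|b M| * 0.
  apply: cvgMr; apply: cvg_expr; rewrite ger0_norm//; lra.
rewrite mulr0 => /cvgr0Pnorm_le/(_ (eps / 2) ltac:(by rewrite divr_gt0)) [K _ KP].
exists (M + K)%N => // n /= Kn.
have Mn : (M <= n)%N := leq_trans (leq_addr _ _) Kn.
rewrite -(subnKC Mn); apply: le_trans (bk _) _.
have := KP (n - M)%N ltac:(by rewrite /= leq_subRL).
by rewrite ger0_norm ?mulr_ge0// => ?; lra.
Qed.

Section OrbitDecay.
Context {R : realType} {X : completeNormedModType R} (C : set X).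
Hypothesis hC : ordered_banach_cone C.
Variables (G : {linear X -> X}).
Hypotheses (cG : compact_operator G) (ctG : continuous G).
Hypothesis posG : forall x, C x -> C (G x).

Lemma iter_pos m x : C x -> C (iter m G x).
Proof. by elim: m => //= m IH /IH; exact: posG. Qed.

(** Three quantities are shown to vanish in turn, each dominated by the previous
    one plus half of itself one step earlier: the norm [h m] of the functional
    [u' \o G^m], the norm [k m] of [G^m] on the cone, and the norm [a m] of
    [G^m]. *)
Lemma orbit_decay_norm_decay u (u' : {linear X -> R^o}) :
  almost_interior C u -> strictly_positive C u' ->
  (fun m => u' (iter m G u) : R) @ \oo --> (0 : R) ->
  exists m, forall x, `|iter m G x| <= 2^-1 * `|x|.
Proof.
move=> hu hu' e0.
have [[cu' u'C] _] := hu'.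
have [B [B0 u'B]] := continuous_linear_bound cu'.
have [M [M0 GM]] := continuous_linear_bound ctG.
have [N1 [N10 N1P]] := compact_order_bound hC cG hu.
have [N2 [N20 N2P]] := compact_strictly_positive_bound hC cG ctG posG hu'
  (ltac:(by rewrite invr_gt0) : 0 < 2^-1 :> R).
pose e m : R := u' (iter m G u).
have e_ge0 m : 0 <= e m by apply: u'C; apply: iter_pos; case: hu.
pose rec (N : R) (e : nat -> R) (b0 : R) :=
  fix b m := if m is m'.+1 then N * e m' + 2^-1 * b m' else b0.
have rec_ge0 N d b0 : 0 <= N -> (forall m, 0 <= d m) -> 0 <= b0 ->
    forall m, 0 <= rec N d b0 m.
  by move=> N_ge0 d0 b00; elim=> //= m IH; rewrite addr_ge0// mulr_ge0.
pose h := rec N1 e B.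
have h_ge0 : forall m, 0 <= h m by apply: rec_ge0 => //; exact: ltW.
have h0 : h @ \oo --> 0 by apply: (@halving_recursion_cvg0 _ N1 e).
have hP m x : `|u' (iter m G x)| <= h m * `|x|.
  elim: m x => [|m IH] x; first exact: u'B.
  have ub y : u' (iter m.+1 G y) <= h m.+1 * `|y|.
    rewrite iterSr.
    have [a [c [/andP[a0 aN] Cc yac]]] := N1P y.
    have -> : G y = (a *: u - c) + (G y - (a *: u - c)) by rewrite addrC subrK.
    rewrite iter_linearD iter_linearB iter_linearZ linearD linearB linearZ/=.
    have h1 : a * e m <= N1 * `|y| * e m by rewrite ler_wpM2r.
    have h2 : 0 <= u' (iter m G c) by apply: u'C; exact: iter_pos.
    have h3 := le_trans (ler_norm _) (IH (G y - (a *: u - c))).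
    have h4 : h m * `|G y - (a *: u - c)| <= h m * (2^-1 * `|y|).
      by rewrite ler_wpM2l.
    rewrite /h/= -/(h m) -[a *: u' _]/(a * e m).
    have -> : (N1 * e m + 2^-1 * h m) * `|y| = N1 * `|y| * e m + h m * (2^-1 * `|y|) by ring.
    lra.
  rewrite ler_norml ub andbT.
  by have := ub (- x); rewrite normrN -[- x]scaleN1r iter_linearZ scaleN1r linearN; lra.
pose k := rec N2 (fun m => h m.+1) 1.
have k_ge0 : forall m, 0 <= k m by apply: rec_ge0 => //; exact: ltW.
have k0 : k @ \oo --> 0.
  by apply: (@halving_recursion_cvg0 _ N2 (fun m => h m.+1)) => //; rewrite cvg_shiftS.
have kP m x : C x -> `|iter m G x| <= k m * `|x|.
  move=> Cx; elim: m => [|m IH]; first by rewrite mul1r.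
  apply: le_trans (N2P _ (iter_pos _ Cx)) _.
  rewrite /k/= -/(k m) mulrDl -!mulrA; apply: lerD.
    by rewrite ler_wpM2l ?(ltW N20)//; apply: le_trans (ler_norm _) (hP m.+1 x).
  by rewrite ler_wpM2l ?invr_ge0.
pose N3 := N1 * `|u| + (M + N1 * `|u| + 2^-1).
have N3_ge0 : 0 <= N3.
  by rewrite !addr_ge0// ?mulr_ge0// ?invr_ge0// ltW.
pose a := rec N3 k 1.
have a_ge0 : forall m, 0 <= a m by exact: rec_ge0.
have a0 : a @ \oo --> 0 by exact: (@halving_recursion_cvg0 _ N3 k).
have aP m x : `|iter m G x| <= a m * `|x|.
  elim: m x => [|m IH] x; first by rewrite mul1r.
  rewrite iterSr; have [t [c [/andP[t0 tN] Cc yac]]] := N1P x.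
  set w := G x - (t *: u - c) in yac.
  have Ew : G x = (t *: u - c) + w by rewrite /w addrC subrK.
  have c_le : `|c| <= (M + N1 * `|u| + 2^-1) * `|x|.
    have -> : c = t *: u - G x + w by rewrite /w addrA subrK subKr.
    apply: le_trans (ler_normD _ _) _.
    have := ler_normB (t *: u) (G x); rewrite normrZ ger0_norm// => h1.
    have h2 : t * `|u| <= N1 * `|x| * `|u| by rewrite ler_wpM2r.
    have := GM x; have -> : (M + N1 * `|u| + 2^-1) * `|x| =
      M * `|x| + N1 * `|x| * `|u| + 2^-1 * `|x| by ring.
    lra.
  rewrite Ew iter_linearD iter_linearB iter_linearZ.
  apply: le_trans (ler_normD _ _) _.
  have h1 := IH w.
  have h2 := ler_normB (t *: iter m G u) (iter m G c).
  rewrite normrZ ger0_norm// in h2.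
  have h3 : t * `|iter m G u| <= N1 * `|x| * (k m * `|u|).
    by apply: ler_pM => //; apply: kP; case: hu.
  have h4 : `|iter m G c| <= k m * ((M + N1 * `|u| + 2^-1) * `|x|).
    by apply: le_trans (kP _ _ Cc) _; rewrite ler_wpM2l.
  have h5 : a m * `|w| <= a m * (2^-1 * `|x|) by rewrite ler_wpM2l.
  rewrite /a/= -/(a m).
  have -> : (N3 * k m + 2^-1 * a m) * `|x| = N1 * `|x| * (k m * `|u|) +
    k m * ((M + N1 * `|u| + 2^-1) * `|x|) + a m * (2^-1 * `|x|) by rewrite /N3; ring.
  lra.
have [m _ mP] := (cvgr0Pnorm_le _).1 a0 _ (ltac:(by rewrite invr_gt0) : 0 < 2^-1 :> R).
exists m => x; apply: le_trans (aP m x) _.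
by rewrite ler_wpM2r//; apply: le_trans (ler_norm _) (mP m (leqnn _)).
Qed.

End OrbitDecay.

(** * Circles without eigenvalues of a compact operator *)

Section Quadratic.
Context {R : realType} {X : completeNormedModType R} (G : {linear X -> X}).

(** [G] is annihilated on the span of [x] and [G x] by the polynomial
    [t^2 - 2 c t + rho^2], whose roots are the complex numbers of modulus [rho]
    and real part [c]. *)
Definition eigenplane (rho c : R) (x : X) : Prop :=
  [/\ x != 0, `|c| <= rho & G (G x) = (2 * c) *: G x - rho ^+ 2 *: x].

Definition quad (rho c : R) (x : X) : X :=
  G (G x) - (2 * c) *: G x + rho ^+ 2 *: x.

Lemma quad_linear rho c : linear (quad rho c).
Proof. move=> t x y; rewrite /quad !linearP/=; module_eq R X; ring. Qed.
HB.instance Definition _ rho c :=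
  GRing.isLinear.Build R X X *:%R (quad rho c) (quad_linear rho c).

Lemma quad_eigenplane rho c x : eigenplane rho c x -> quad rho c x = 0.
Proof. by move=> [_ _ Gx]; rewrite /quad Gx; module_eq R X; ring. Qed.

Lemma quad_comm rho c rho' c' x :
  quad rho c (quad rho' c' x) = quad rho' c' (quad rho c x).
Proof.
rewrite /quad !(linearD G, linearN G, linearZ_LR G).
by module_eq R X; ring.
Qed.

(** A common kernel vector [z] satisfies [G z = k z] with [k] real, so [k] is a
    real root of both quadratics. Their discriminants are nonpositive, so it is
    a double root of each, and [k ^+ 2] equals both constant terms. *)
Lemma quad_inj rho c rho' c' z : 0 < rho -> 0 < rho' -> rho != rho' ->
  `|c| <= rho -> `|c'| <= rho' -> quad rho c z = 0 -> quad rho' c' z = 0 -> z = 0.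
Proof.
move=> r0 r0' rr' cr cr' qz qz'; apply: contrapT => /eqP z0.
have e : (2 * (c - c')) *: G z = (rho ^+ 2 - rho' ^+ 2) *: z.
  transitivity ((rho ^+ 2 - rho' ^+ 2) *: z - quad rho c z + quad rho' c' z).
    by rewrite /quad; module_eq R X; ring.
  by rewrite qz qz' subr0 addr0.
have rr : rho ^+ 2 - rho' ^+ 2 != 0.
  by rewrite subr_eq0 eqrXn2// ltW.
have cc' : 2 * (c - c') != 0.
  apply: contra_neq rr => c0; move/eqP: e; rewrite c0 scale0r eq_sym scaler_eq0.
  by rewrite (negbTE z0) orbF => /eqP.
pose k := (rho ^+ 2 - rho' ^+ 2) / (2 * (c - c')).
have Gz : G z = k *: z by rewrite /k mulrC -scalerA -e scalerA mulVf// scale1r.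
have quadk r d : quad r d z = (k ^+ 2 - 2 * d * k + r ^+ 2) *: z.
  rewrite /quad !(Gz, linearZ_LR G); module_eq R X; ring.
have root r d : quad r d z = 0 -> k ^+ 2 - 2 * d * k + r ^+ 2 = 0.
  by rewrite quadk => /eqP; rewrite scaler_eq0 (negbTE z0) orbF => /eqP.
(* a real root of a quadratic with nonpositive discriminant is double *)
have k2E r d : 0 < r -> `|d| <= r -> quad r d z = 0 -> k ^+ 2 = r ^+ 2.
  move=> rp dr /root k2.
  have d2 : d ^+ 2 <= r ^+ 2.
    by rewrite -[leLHS]real_normK ?num_real// lerXn2r ?nnegrE// ltW.
  have kd2 : (k - d) ^+ 2 = k ^+ 2 - 2 * d * k + d ^+ 2 by ring.
  have : (k - d) ^+ 2 == 0 by rewrite eq_le sqr_ge0 andbT; lra.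
  rewrite sqrf_eq0 subr_eq0 => /eqP kd; move: k2 kd2; rewrite -kd subrr expr0n/=.
  lra.
have : rho' ^+ 2 = rho ^+ 2 by rewrite -(k2E _ _ r0 cr qz) (k2E _ _ r0' cr' qz').
by move=> /eqP; rewrite eq_sym -subr_eq0 (negbTE rr).
Qed.

Section GoodRadius.
Variables (rad re : nat -> R) (x : nat -> X) (r1 r2 : R).
Hypotheses (r1_gt0 : 0 < r1) (rad_itv : forall m, r1 <= rad m <= r2)
  (rad_inj : forall i m, (i < m)%N -> rad i != rad m)
  (xP : forall m, eigenplane (rad m) (re m) (x m)).
Hypotheses (cG : compact_operator G) (ctG : continuous G).

(** The kernel of [quads m] stands for the span of the first [m] planes: it is
    invariant under [G], and closed without any argument on dimensions. *)
Fixpoint quads (m : nat) (z : X) : X :=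
  if m is m'.+1 then quad (rad m') (re m') (quads m' z) else z.

Lemma quads_linear m : linear (quads m).
Proof. by elim: m => //= m IH t y z; rewrite IH linearP. Qed.
HB.instance Definition _ m :=
  GRing.isLinear.Build R X X *:%R (quads m) (quads_linear m).

Lemma quads_comm m rho c z : quads m (quad rho c z) = quad rho c (quads m z).
Proof. by elim: m => //= m ->; rewrite quad_comm. Qed.

Lemma quads_eq0_leq l m z : (l <= m)%N -> quads l z = 0 -> quads m z = 0.
Proof.
move=> /subnKC <-; elim: (m - l)%N => [|k IH] z0; first by rewrite addn0.
by rewrite addnS/= IH// linear0.
Qed.

Lemma quads_bound m : exists M, forall z, `|quads m z| <= M * `|z|.
Proof.
have [M [M0 GM]] := continuous_linear_bound ctG.
elim: m => [|m [N NP]]; first by exists 1 => z; rewrite mul1r.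
have qb rho c : exists B, 0 <= B /\ forall z, `|quad rho c z| <= B * `|z|.
  exists (M * M + `|2 * c| * M + rho ^+ 2); split.
    by rewrite !addr_ge0// ?sqr_ge0// mulr_ge0// ltW.
  move=> z; rewrite /quad.
  apply: le_trans (ler_normD _ _) _; rewrite [leRHS]mulrDl.
  apply: lerD; last by rewrite normrZ ger0_norm// sqr_ge0.
  apply: le_trans (ler_normB _ _) _; rewrite [leRHS]mulrDl normrZ.
  apply: lerD; last by rewrite -mulrA ler_wpM2l.
  by apply: le_trans (GM _) _; rewrite -mulrA ler_wpM2l// ltW.
have [B [B0 BP]] := qb (rad m) (re m).
exists (B * N) => z /=; apply: le_trans (BP _) _.
by rewrite -mulrA ler_wpM2l.
Qed.

Lemma quads_neq0 m : quads m (x m) != 0.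
Proof.
have [x0 cr _] := xP m; have qx := quad_eigenplane (xP m).
have rad0 i : 0 < rad i by have /andP[+ _] := rad_itv i; exact: lt_le_trans.
have : forall k, (k <= m)%N -> quads k (x m) != 0.
  elim=> [//|k IH] km /=; apply/negP => /eqP e.
  have /negP := IH (ltnW km); apply; apply/eqP.
  apply: (quad_inj (rad0 m) (rad0 k) _ cr _ _ e).
  - by rewrite eq_sym rad_inj.
  - by have [] := xP k.
  - by rewrite -quads_comm qx linear0.
exact.
Qed.

(** Riesz's lemma for the increasing chain of kernels of [quads]; the vector
    [x m] shows that the chain increases strictly. *)
Lemma quads_riesz m : exists y, [/\ `|y| <= 1, quads m.+1 y = 0 &
  forall z, quads m z = 0 -> 2^-1 <= `|y - z|].
Proof.
have [B BP] := quads_bound m.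
have px : 0 < `|quads m (x m)| by rewrite normr_gt0 quads_neq0.
pose S := [set `|x m - z| | z in [set z | quads m z = 0]].
have hS : has_inf S.
  by split; [exists `|x m - 0|, 0 => //=; rewrite linear0|exists 0 => _ [z _ <-]].
have B0 : 0 < B.
  rewrite ltNge; apply/negP => Bneg.
  have := BP (x m); rewrite leNgt => /negP; apply.
  by apply: le_lt_trans px; rewrite mulr_le0_ge0.
have d0 : 0 < inf S.
  apply: lt_le_trans (_ : `|quads m (x m)| / B <= _); first exact: divr_gt0.
  apply: lb_le_inf; first exact: hS.1.
  move=> _ [z /= z0 <-]; rewrite ler_pdivrMr// mulrC.
  by apply: le_trans (BP _); rewrite linearB/= z0 subr0.
have [_ [z0 /= qz0 <-] zd] := inf_adherent d0 hS.
set w := x m - z0 in zd *.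
have dw : inf S <= `|w| by apply: ge_inf; [exact: hS.2|exists z0].
have w0 : 0 < `|w| := lt_le_trans d0 dw.
exists (`|w|^-1 *: w); split.
- by rewrite normrZ normfV normr_id mulVf// gt_eqF.
- rewrite linearZ/= linearB/= qz0 subr0 linearZ/= -quads_comm.
  by rewrite (quad_eigenplane (xP m)) linear0 scaler0.
- move=> z qz.
  have -> : `|w|^-1 *: w - z = `|w|^-1 *: (x m - (z0 + `|w| *: z)).
    by rewrite /w; module_eq R X; field; rewrite gt_eqF.
  rewrite normrZ normfV normr_id ler_pdivlMl// mulrC.
  apply: le_trans (_ : inf S <= _); first by move: zd; lra.
  apply: ge_inf; first exact: hS.2.
  by exists (z0 + `|w| *: z) => //=; rewrite linearD linearZ/= qz0 qz scaler0 addr0.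
Qed.

(** On the kernel of [quads m.+1], the operator [(2 (re m) G - G^2) / (rad m)^2]
    is the identity modulo the kernel of [quads m]. Applied to the vectors of
    Riesz's lemma, it gives a sequence without cluster point, against the
    compactness of [G]. *)
Lemma no_eigenplane_sequence : False.
Proof.
have /choice[y yP] := quads_riesz.
have rad0 i : 0 < rad i by have /andP[+ _] := rad_itv i; exact: lt_le_trans.
pose w m := (rad m ^+ 2)^-1 *: ((2 * re m) *: G (y m) - G (G (y m))).
have wE m : y m - w m = (rad m ^+ 2)^-1 *: quad (rad m) (re m) (y m).
  by rewrite /w /quad; module_eq R X; field; rewrite gt_eqF.
have ywm m : quads m (y m - w m) = 0.
  by have [_ /= e _] := yP m; rewrite wE linearZ/= quads_comm e scaler0.
have wl l m : (l < m)%N -> quads m (w l) = 0.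
  move=> lm; have -> : w l = y l - (y l - w l) by rewrite subKr.
  rewrite linearB/= (quads_eq0_leq (ltnW lm) (ywm l)) subr0.
  by apply: quads_eq0_leq lm _; have [] := yP l.
have far l m : (l < m)%N -> 2^-1 <= `|w m - w l|.
  move=> lm; have [_ _ /(_ (y m - w m + w l))] := yP m.
  rewrite linearD/= ywm wl// addr0 => /(_ erefl).
  by rewrite opprD addrA subKr.
have [U [UU Uoo]] := ultra_eventually.
have [rho [/andP[rho1 _] radU]] := bounded_ultra_cvg UU rad_itv.
have reb m : - r2 <= re m <= r2.
  rewrite -ler_norml; have [_ /le_trans + _] := xP m; apply.
  by have /andP[] := rad_itv m.
have [c [_ reU]] := bounded_ultra_cvg UU reb.
have [g gU] := compact_operator_ultra_cvg UU cG (fun m => let: And3 h _ _ := yP m in h).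
have GgU : G (G (y m)) @[m --> U] --> G g by apply: continuous_cvg => //; exact: ctG.
have wU : w @ U --> (rho ^+ 2)^-1 *: ((2 * c) *: g - G g).
  apply: cvgZ.
    apply: cvgV; first by rewrite expf_neq0// gt_eqF// (lt_le_trans r1_gt0).
    by rewrite expr2; under eq_cvg do rewrite expr2; exact: cvgM.
  by apply: cvgB => //; apply: cvgZ => //; exact: cvgMr.
have e4 : 0 < (4^-1 : R) by rewrite invr_gt0.
have /cvgrPdist_lt/(_ _ e4) near := wU.
have [l wl4] := filter_ex near.
have lU : \forall m \near U, (l < m)%N by apply: Uoo; exact: nbhs_infty_gt.
have [m [lm wm4]] := filter_ex (filterI lU near).
have := far _ _ lm; move: wl4 wm4; set L := _ *: _; rewrite distrC => wl4 wm4.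
by have := ler_distD L (w m) (w l); rewrite (distrC (w m) L) (distrC L (w l)); lra.
Qed.

End GoodRadius.
End Quadratic.

Lemma exists_radius_without_eigenplane (R : realType) (X : completeNormedModType R)
    (G : {linear X -> X}) (r1 r2 : R) :
  compact_operator G -> continuous G -> 0 < r1 -> r1 < r2 ->
  exists rho, r1 < rho < r2 /\ forall c x, ~ eigenplane G rho c x.
Proof.
move=> cG ctG r10 r12; apply: contrapT => no.
pose rad (m : nat) := r1 + (r2 - r1) / m.+2%:R.
have rad_itv m : r1 < rad m < r2.
  rewrite /rad ltrDl divr_gt0 ?subr_gt0//= -ltrBrDl ltr_pdivrMr//.
  by rewrite ltr_pMr ?subr_gt0// ltr1n.
have : forall m, exists p : R * X, eigenplane G (rad m) p.1 p.2.
  move=> m; apply: contrapT => nP; apply: no; exists (rad m); split=> // c x xP.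
  by apply: nP; exists (c, x).
move=> /choice[p pP].
apply: (@no_eigenplane_sequence _ _ _ rad (fun m => (p m).1) (fun m => (p m).2) r1 r2) => //.
- by move=> m; have /andP[/ltW -> /ltW ->] := rad_itv m.
- move=> i m im; rewrite gt_eqF// ltrD2l ltr_pM2l ?subr_gt0//.
  by rewrite ltf_pV2 ?posrE// ltr_nat !ltnS.
Qed.

(** * Uniform lower bounds on a circle without eigenvalues *)

Lemma norm_le_radius (R : realType) (c s rho : R) :
  0 < rho -> c ^+ 2 + s ^+ 2 = rho ^+ 2 -> `|c| <= rho.
Proof.
move=> r0 cs; rewrite -(@ler_pXn2r _ 2)// ?nnegrE ?normr_ge0 ?(ltW r0)//.
by rewrite real_normK ?num_real// -cs lerDl sqr_ge0.
Qed.

Section Dichotomy.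
Context {R : realType} {X : completeNormedModType R} (G : {linear X -> X}).
Hypotheses (cG : compact_operator G) (ctG : continuous G).
Variable rho : R.
Hypotheses (rho0 : 0 < rho) (no_plane : forall c x, ~ eigenplane G rho c x).

(** Eliminating one of [a] and [b] from the eigenvalue equation of [a + i b]
    leaves the quadratic equation of a plane. *)
Lemma no_eigenvalue_on_circle c s (a b : X) : c ^+ 2 + s ^+ 2 = rho ^+ 2 ->
  G a = c *: a - s *: b -> G b = s *: a + c *: b -> a = 0 /\ b = 0.
Proof.
move=> cs Ga Gb.
have cr := norm_le_radius rho0 cs.
split; apply: contrapT => /eqP n0.
  apply: (@no_plane c a); split => //.
  rewrite {1}Ga linearB/= !(linearZ_LR G) Gb Ga -cs; module_eq R X; ring.
apply: (@no_plane c b); split => //.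
rewrite {1}Gb linearD/= !(linearZ_LR G) Ga Gb -cs; module_eq R X; ring.
Qed.

(** The right-hand side measures [(G - z) (a + i b)] for [z = c + i s]. If it
    could be small on unit vectors, these would converge along an ultrafilter to
    an eigenvector, since [a + i b] is recovered from its image under [G] by
    dividing by [z]. *)
Lemma circle_bounded_below : exists g : R, 0 < g /\
  forall c s (a b : X), c ^+ 2 + s ^+ 2 = rho ^+ 2 ->
  g * (`|a| + `|b|) <= `|G a - c *: a + s *: b| + `|G b - s *: a - c *: b|.
Proof.
apply: contrapT => no.
have : forall n : nat, exists p : R * R * (X * X),
    [/\ p.1.1 ^+ 2 + p.1.2 ^+ 2 = rho ^+ 2, `|p.2.1| + `|p.2.2| = 1 &
    `|G p.2.1 - p.1.1 *: p.2.1 + p.1.2 *: p.2.2| +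
    `|G p.2.2 - p.1.2 *: p.2.1 - p.1.1 *: p.2.2| < n.+1%:R^-1].
  move=> n; apply: contrapT => nP; apply: no; exists n.+1%:R^-1.
  split=> [|c s a b cs]; first by rewrite invr_gt0.
  rewrite leNgt; apply/negP => lt; apply: nP.
  have [ab0|ab0] := eqVneq (`|a| + `|b|) 0.
    by move: lt; rewrite ab0 mulr0 ltNge addr_ge0.
  have ab_gt0 : 0 < `|a| + `|b| by rewrite lt_neqAle eq_sym ab0/= addr_ge0.
  set t := (`|a| + `|b|)^-1; have t0 : 0 < t by rewrite invr_gt0.
  exists ((c, s), (t *: a, t *: b)); split => //=.
    by rewrite !normrZ gtr0_norm// -mulrDr mulVf.
  rewrite !(linearZ_LR G).
  have -> : t *: G a - c *: (t *: a) + s *: (t *: b) = t *: (G a - c *: a + s *: b).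
    by module_eq R X; ring.
  have -> : t *: G b - s *: (t *: a) - c *: (t *: b) = t *: (G b - s *: a - c *: b).
    by module_eq R X; ring.
  by rewrite !normrZ gtr0_norm// -mulrDr ltr_pdivrMl// mulrC.
move=> /choice[p pP]; have [U [UU Uoo]] := ultra_eventually.
pose c n := (p n).1.1; pose s n := (p n).1.2; pose a n := (p n).2.1; pose b n := (p n).2.2.
have csn n : c n ^+ 2 + s n ^+ 2 = rho ^+ 2 by have [] := pP n.
have abn n : `|a n| + `|b n| = 1 by have [] := pP n.
have e0 : (fun n : nat => n.+1%:R^-1 : R) @ U --> (0 : R).
  by apply: cvg_trans (@cvg_harmonic R); exact: cvg_app.
have [err1 err2] : (fun n => G (a n) - c n *: a n + s n *: b n) @ U --> (0 : X) /\
    (fun n => G (b n) - s n *: a n - c n *: b n) @ U --> (0 : X).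
  split; apply/cvgr0Pnorm_lt => e ep; have /cvgr0Pnorm_lt/(_ _ ep) := e0.
    apply: filterS => n; rewrite gtr0_norm ?invr_gt0//; apply: le_lt_trans.
    by have [_ _ /ltW] := pP n; apply: le_trans; rewrite lerDl.
  apply: filterS => n; rewrite gtr0_norm ?invr_gt0//; apply: le_lt_trans.
  by have [_ _ /ltW] := pP n; apply: le_trans; rewrite lerDr.
have sq_itv x y : x ^+ 2 + y ^+ 2 = rho ^+ 2 -> - rho <= x <= rho.
  by move=> xy; rewrite -ler_norml; exact: norm_le_radius xy.
have [c' [_ cU]] := bounded_ultra_cvg UU (fun n => sq_itv _ _ (csn n)).
have [s' [_ sU]] := bounded_ultra_cvg UU
  (fun n => sq_itv (s n) (c n) (etrans (addrC _ _) (csn n))).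
have [alpha aU] : exists l : X, (fun n => G (a n)) @ U --> l.
  by apply: (compact_operator_ultra_cvg (B := 1) UU cG) => n; rewrite -(abn n) lerDl.
have [beta bU] : exists l : X, (fun n => G (b n)) @ U --> l.
  by apply: (compact_operator_ultra_cvg (B := 1) UU cG) => n; rewrite -(abn n) lerDr.
pose P n := G (a n) - (G (a n) - c n *: a n + s n *: b n).
pose Q n := G (b n) - (G (b n) - s n *: a n - c n *: b n).
have PU : P @ U --> alpha by rewrite -[alpha]subr0; apply: cvgB.
have QU : Q @ U --> beta by rewrite -[beta]subr0; apply: cvgB.
have r2 : rho ^+ 2 != 0 by rewrite expf_neq0// gt_eqF.
have aE n : a n = (rho ^+ 2)^-1 *: (c n *: P n + s n *: Q n).
  by rewrite /P /Q -(csn n); module_eq R X; field; rewrite csn.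
have bE n : b n = (rho ^+ 2)^-1 *: (c n *: Q n - s n *: P n).
  by rewrite /P /Q -(csn n); module_eq R X; field; rewrite csn.
have a'U : a @ U --> (rho ^+ 2)^-1 *: (c' *: alpha + s' *: beta).
  by rewrite (funext aE); apply: cvgZr; apply: cvgD; apply: cvgZ.
have b'U : b @ U --> (rho ^+ 2)^-1 *: (c' *: beta - s' *: alpha).
  by rewrite (funext bE); apply: cvgZr; apply: cvgB; apply: cvgZ.
move: a'U b'U; set a' := _ *: _; set b' := _ *: _ => a'U b'U.
have Ga' : G a' = alpha.
  by apply: cvg_unique aU => //; apply: continuous_cvg => //; exact: ctG.
have Gb' : G b' = beta.
  by apply: cvg_unique bU => //; apply: continuous_cvg => //; exact: ctG.
have cs' : c' ^+ 2 + s' ^+ 2 = rho ^+ 2.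
  have : (fun n => c n ^+ 2 + s n ^+ 2) @ U --> c' ^+ 2 + s' ^+ 2.
    by apply: cvgD; rewrite !expr2; apply: cvgM.
  rewrite (funext csn) => h; apply: (cvg_unique _ h) => //; exact: cvg_cst.
have ab' : `|a'| + `|b'| = 1.
  have : (fun n => `|a n| + `|b n|) @ U --> `|a'| + `|b'|.
    by apply: cvgD; apply: cvg_norm.
  rewrite (funext abn) => h; apply: (cvg_unique _ h) => //; exact: cvg_cst.
have [a0 b0] : a' = 0 /\ b' = 0.
  apply: (no_eigenvalue_on_circle cs').
    by rewrite Ga' /a' /b' -cs'; module_eq R X; field; rewrite cs'.
  by rewrite Gb' /a' /b' -cs'; module_eq R X; field; rewrite cs'.
by move: ab'; rewrite a0 b0 normr0 addr0 => /eqP; rewrite eq_sym oner_eq0.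
Unshelve. all: by end_near. Qed.

End Dichotomy.

(** * Orbits of a compact operator never collapse after growing *)

(** Multiplied by [sin f], where [f] is half the angle, the sum of the real
    parts of the powers of a root of unity telescopes. *)
Lemma sum_cos_root (R : realType) (n d : nat) : (0 < d < n)%N ->
  \sum_(0 <= j < n) cos (d%:R * (2 * pi * j%:R / n%:R)) = 0 :> R.
Proof.
move=> /andP[d0 dn].
have n0 : 0 < n%:R :> R by rewrite ltr0n (leq_trans _ dn).
pose f : R := pi * d%:R / n%:R.
have sf : 0 < sin f.
  apply: sin_gt0_pi; rewrite divr_gt0 ?mulr_gt0 ?pi_gt0 ?n0 ?(ltr0n _ d)//=.
  by rewrite ltr_pdivrMr// ltr_pM2l ?pi_gt0// ltr_nat.
apply: (mulfI (lt0r_neq0 sf)); rewrite mulr0 mulr_sumr.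
have step j : sin f * cos (d%:R * (2 * pi * j%:R / n%:R)) =
    2^-1 * sin ((2 * j.+1%:R - 1) * f) - 2^-1 * sin ((2 * j%:R - 1) * f).
  have -> : d%:R * (2 * pi * j%:R / n%:R) = 2 * j%:R * f by rewrite /f; field; rewrite gt_eqF.
  have -> : (2 * j.+1%:R - 1) * f = 2 * j%:R * f + f by rewrite -natr1; ring.
  have -> : (2 * j%:R - 1) * f = 2 * j%:R * f - f by ring.
  by rewrite sinD sinB; field.
under eq_bigr do rewrite step.
rewrite telescope_sumr// mulr0 sub0r mulN1r sinN.
have -> : (2 * n%:R - 1) * f = - f + pi *+ 2 *+ d.
  rewrite -mulrnA -(mulr_natr pi) natrM /f; field; rewrite gt_eqF//.
by rewrite (periodicn (@sinD2pi R)) sinN subrr.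
Qed.

Section OrbitDichotomy.
Context {R : realType} {X : completeNormedModType R} (G : {linear X -> X}).
Hypotheses (cG : compact_operator G) (ctG : continuous G).
Variable rho : R.
Hypotheses (rho0 : 0 < rho) (no_plane : forall c x, ~ eigenplane G rho c x).

(** The discrete Fourier transform [A j + i B j] of the rescaled orbit
    [y k = rho^-k G^k x], [k < n], is mapped by [G - rho exp (i th j)] to a
    combination of the end points [y 0] and [y n] alone. The lower bound on the
    circle therefore controls the transform by the end points, and the inversion
    formula controls every [y l]. *)
Lemma orbit_dichotomy : exists M, 0 < M /\ forall x n l, (l < n)%N ->
  `|iter l G x| / rho ^+ l <= M * (`|x| + `|iter n G x| / rho ^+ n).
Proof.
have [g [g0 gP]] := circle_bounded_below cG ctG rho0 no_plane.
exists (2 * rho / g); split; first by rewrite divr_gt0// mulr_gt0.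
move=> x n l ln.
have n0 : (0 < n)%N := leq_ltn_trans (leq0n l) ln.
pose y k := (rho ^+ k)^-1 *: iter k G x.
have Gy k : G (y k) = rho *: y k.+1.
  rewrite /y linearZ/= scalerA; congr (_ *: _).
  by rewrite exprS invfM mulVKf// gt_eqF.
have ny k : `|y k| = `|iter k G x| / rho ^+ k.
  by rewrite /y normrZ mulrC gtr0_norm// invr_gt0 exprn_gt0.
pose th j : R := 2 * pi * j%:R / n%:R.
pose A j := \sum_(0 <= k < n) cos (k%:R * th j) *: y k.
pose B j := - \sum_(0 <= k < n) sin (k%:R * th j) *: y k.
pose E := `|x| + `|iter n G x| / rho ^+ n.
have yE : `|y n| + `|y 0%N| = E by rewrite !ny expr0 divr1 addrC.
have kth k j : k.+1%:R * th j - th j = k%:R * th j by rewrite -natr1; ring.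
have AB j : `|A j| + `|B j| <= 2 * rho / g * E.
  pose t := th j.
  have := gP (rho * cos t) (rho * sin t) (A j) (B j).
  rewrite !exprMn -mulrDr cos2Dsin2 mulr1 => /(_ erefl) le.
  have eA : G (A j) - (rho * cos t) *: A j + (rho * sin t) *: B j =
      rho *: (cos (n%:R * t - t) *: y n - cos (0%:R * t - t) *: y 0%N).
    rewrite -(telescope_sumr (fun k => cos (k%:R * t - t) *: y k))// /A /B.
    rewrite linear_sum scalerN !scaler_sumr -!sumrB; apply: eq_bigr => k _.
    rewrite linearZ_LR Gy kth (cosB (k%:R * th j) t) -/t.
    by module_eq R X; ring.
  have eB : G (B j) - (rho * sin t) *: A j - (rho * cos t) *: B j =
      - (rho *: (sin (n%:R * t - t) *: y n - sin (0%:R * t - t) *: y 0%N)).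
    rewrite -(telescope_sumr (fun k => sin (k%:R * t - t) *: y k))// /A /B.
    rewrite linearN linear_sum scalerN opprK !scaler_sumr -!sumrN -!big_split.
    apply: eq_bigr => k _.
    rewrite linearZ_LR Gy kth (sinB (k%:R * th j) t) -/t /=.
    by module_eq R X; ring.
  have le1 (c s : R) : `|c| <= 1 -> `|s| <= 1 -> `|c *: y n - s *: y 0%N| <= E.
    move=> c1 s1; apply: le_trans (ler_normB _ _) _; rewrite -yE !normrZ.
    by apply: lerD; rewrite -[leRHS]mul1r ler_wpM2r.
  move: le; rewrite eA eB [`|- (rho *: _)|]normrN !normrZ gtr0_norm//.
  have h1 := le1 _ _ (cos_max (n%:R * t - t)) (cos_max (0%:R * t - t)).
  have h2 := le1 _ _ (sin_max (n%:R * t - t)) (sin_max (0%:R * t - t)).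
  move=> le; rewrite mulrAC ler_pdivlMr// mulrC; apply: le_trans le _.
  by rewrite -mulrDr [2 * _]mulrC -mulrA ler_pM2l// mulrDl mul1r lerD.
have nR : 0 < n%:R :> R by rewrite ltr0n.
have inv : y l = n%:R^-1 *: \sum_(0 <= j < n)
    (cos (l%:R * th j) *: A j - sin (l%:R * th j) *: B j).
  pose W k := \sum_(0 <= j < n) cos (l%:R * th j - k%:R * th j).
  have -> : \sum_(0 <= j < n) (cos (l%:R * th j) *: A j - sin (l%:R * th j) *: B j) =
      \sum_(0 <= k < n) W k *: y k.
    rewrite /W; under [RHS]eq_bigr do rewrite scaler_suml.
    rewrite exchange_big/=; apply: eq_bigr => j _.
    rewrite /A /B scalerN opprK !scaler_sumr -big_split/=; apply: eq_bigr => k _.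
    by rewrite [in RHS]cosB; module_eq R X; ring.
  have cs k : (k < n)%N -> k != l -> W k = 0.
    rewrite /W => kn; rewrite neq_ltn => /orP[kl|lk].
      rewrite -[RHS](@sum_cos_root R n (l - k)); last first.
        by rewrite subn_gt0 kl (leq_ltn_trans (leq_subr _ _)).
      by apply: eq_bigr => j _; rewrite -mulrBl natrB// ltnW.
    rewrite -[RHS](@sum_cos_root R n (k - l)); last first.
      by rewrite subn_gt0 lk (leq_ltn_trans (leq_subr _ _)).
    by apply: eq_bigr => j _; rewrite -cosN -mulrBl -mulNr opprB natrB// ltnW.
  rewrite big_mkord (bigD1 (Ordinal ln))//= big1 ?addr0; last first.
    by move=> k kl; rewrite cs ?scale0r//.
  rewrite /W; under eq_bigr do rewrite subrr cos0.
  by rewrite sumr_const_nat subn0 scalerA -mulr_natl mulr1 mulVf ?scale1r// gt_eqF.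
rewrite -ny inv normrZ gtr0_norm ?invr_gt0// ler_pdivrMl//.
apply: le_trans (ler_norm_sum _ _ _) _.
have -> : n%:R * (2 * rho / g * E) = \sum_(0 <= j < n) (2 * rho / g * E).
  by rewrite sumr_const_nat subn0 mulr_natl.
apply: ler_sum => j _; apply: le_trans (AB j).
apply: le_trans (ler_normB _ _) _; rewrite !normrZ.
by apply: lerD; rewrite -[leRHS]mul1r ler_wpM2r// ?cos_max ?sin_max.
Qed.

(** By the dichotomy on the interval from 0, once [`|G^n x| / rho^n] is large it
    remains large, and a sharp drop between [n] and [n.+1] would bound its value
    at [n] by a multiple of [`|x|]. *)
Lemma outgrowing_orbit_regular x :
  (forall M, exists n, M < `|iter n G x| / rho ^+ n) ->
  exists c, 0 < c /\ \forall n \near \oo,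
    rho ^+ n <= `|iter n G x| /\ c * `|iter n G x| <= `|iter n.+1 G x|.
Proof.
move=> unb; have [M [M0 MP]] := orbit_dichotomy.
pose q n := `|iter n G x| / rho ^+ n.
have qgrow B : \forall n \near \oo, B < q n.
  have [k kB] := unb (M * (`|x| + `|B|)).
  exists k.+1 => // n /= kn; have := lt_le_trans kB (MP x n k kn).
  rewrite ltr_pM2l// ltrD2l; exact: le_lt_trans (ler_norm _).
have r0 n : 0 < rho ^+ n by rewrite exprn_gt0.
exists (rho / (2 * M)); split; first by rewrite divr_gt0// mulr_gt0.
have q1 := qgrow 1; have q2 := qgrow (2 * M * `|x|).
near=> n; split.
  have : 1 < q n by near: n.
  by rewrite /q ltr_pdivlMr// mul1r => /ltW.
have h2 : 2 * M * `|x| < q n by near: n.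
have h1 := MP x n.+1 n (ltnSn n); rewrite -/(q n) in h1.
have : q n <= 2 * M * (`|iter n.+1 G x| / rho ^+ n.+1) by lra.
rewrite /q exprS ler_pdivrMr// => h.
rewrite mulrAC ler_pdivrMr ?mulr_gt0// mulrC -ler_pdivlMr//.
apply: le_trans h _; rewrite le_eqVlt; apply/orP; left; apply/eqP.
by field; rewrite !gt_eqF.
Unshelve. all: by end_near. Qed.

End OrbitDichotomy.

(** * Growth rates of a semigroup *)

Lemma operator_norm_leP (R : realType) (X Y : completeNormedModType R)
    (f : {linear X -> Y}) (B : R) : 0 <= B ->
  (operator_norm f <= B%:E)%E <-> forall x, `|f x| <= B * `|x|.
Proof.
move=> B0; rewrite /operator_norm; split=> [fB x|fB].
  have [->|x0] := eqVneq x 0; first by rewrite linear0 !normr0 mulr0.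
  have nx : 0 < `|x| by rewrite normr_gt0.
  have : (`|f (`|x|^-1 *: x)|%:E <= B%:E)%E.
    apply: le_trans fB; apply: ereal_sup_ubound; exists (`|x|^-1 *: x) => //=.
    by rewrite normrZ normfV normr_id mulVf// gt_eqF.
  by rewrite lee_fin linearZ normrZ normfV normr_id ler_pdivrMl// mulrC.
apply: ge_ereal_sup => _ [x /= x1 <-]; rewrite lee_fin.
by apply: le_trans (fB x) _; rewrite -[leRHS]mulr1 ler_wpM2l.
Qed.

Section Growth.
Context {R : realType} {X : completeNormedModType R} (T : R -> {linear X -> X}).
Hypothesis hT : C0_semigroup T.

Definition growth_rate (w : R) : Prop := exists M : R, 1 <= M /\
  forall t, 0 <= t -> forall x, `|T t x| <= M * expR (t * w) * `|x|.

Lemma growth_boundE :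
  growth_bound T = ereal_inf [set w%:E | w in [set w | growth_rate w]].
Proof.
congr ereal_inf; congr image; apply/seteqP; split=> w /= [M [M1 MP]];
  exists M; split=> // t t0; apply/operator_norm_leP;
  by [rewrite mulr_ge0 ?expR_ge0// (le_trans ler01)|exact: MP].
Qed.

Lemma growth_bound_le w : growth_rate w -> (growth_bound T <= w%:E)%E.
Proof. by move=> gw; rewrite growth_boundE; apply: ereal_inf_lbound; exists w. Qed.

Lemma growth_rate_gt w : (growth_bound T < w%:E)%E -> growth_rate w.
Proof.
rewrite growth_boundE => /ereal_inf_lt[_ [v [M [M1 MP]] <-]]; rewrite lte_fin => vw.
exists M; split=> // t t0 x; apply: le_trans (MP t t0 x) _.
rewrite ler_wpM2r// ler_wpM2l// ?(le_trans ler01)// ler_expR.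
by rewrite ler_wpM2l// ltW.
Qed.

Lemma semigroup_iter (s : R) k x : 0 <= s -> T (k%:R * s) x = iter k (T s) x.
Proof.
move=> s0; elim: k => [|k IH]; first by rewrite mul0r (semigroup_0 hT).
rewrite -nat1r mulrDl mul1r (semigroup_add hT)//; first by rewrite IH.
by rewrite mulr_ge0.
Qed.

Lemma growth_rate_step (s w M0 : R) : 0 < s ->
  (forall t, 0 <= t <= s -> forall x, `|T t x| <= M0 * `|x|) ->
  (forall x, `|T s x| <= expR (s * w) * `|x|) -> growth_rate w.
Proof.
move=> s0 TM Ts; pose M1 := Num.max 1 M0; pose M := M1 * expR (s * `|w|).
have M10 : 0 <= M1 by rewrite le_max ler01.
exists M; split.
  rewrite /M -[leLHS]mulr1 ler_pM//; first by rewrite le_max lexx.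
  by rewrite -expR0 ler_expR mulr_ge0// ltW.
move=> t t0 x; pose k := Num.truncn (t / s).
have ts0 : 0 <= t / s by rewrite divr_ge0// ltW.
have /andP[k1 k2] := truncn_itv ts0; rewrite -/k in k1 k2.
pose r := t - k%:R * s.
have r0 : 0 <= r by rewrite subr_ge0 -ler_pdivlMr.
have rs : r <= s by rewrite lerBlDr -[X in X + _]mul1r -mulrDl nat1r -ler_pdivrMr// ltW.
have -> : t = r + k%:R * s by rewrite subrK.
rewrite (semigroup_add hT)// ?mulr_ge0 ?(ltW s0)// semigroup_iter ?(ltW s0)//.
have it : `|iter k (T s) x| <= expR (k%:R * s * w) * `|x|.
  elim: (k) => [|j IH]; first by rewrite !mul0r expR0 mul1r.
  rewrite /=; apply: le_trans (Ts _) _.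
  rewrite -nat1r !mulrDl mul1r expRD -[leRHS]mulrA ler_wpM2l// expR_ge0//.
apply: le_trans (TM r _ _) _; first by rewrite r0.
apply: le_trans (_ : M1 * (expR (k%:R * s * w) * `|x|) <= _).
  apply: le_trans (_ : M1 * `|iter k (T s) x| <= _); last by rewrite ler_wpM2l.
  by rewrite ler_wpM2r// le_max lexx orbT.
rewrite /M -!mulrA ler_wpM2l// !mulrA ler_wpM2r// -expRD ler_expR.
rewrite [(r + _) * w]mulrDl addrA lerDr -lerBlDr sub0r.
apply: le_trans (_ : r * `|w| <= _); last by rewrite ler_wpM2r.
rewrite -mulrN ler_wpM2l//; have := ler_norm (- w); by rewrite normrN.
Qed.

Lemma semigroup_near0 x e : 0 < e -> exists d : R, 0 < d /\
  forall t, 0 <= t < d -> `|T t x - x| < e.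
Proof.
move=> e0; have /cvgrPdist_lt/(_ _ e0) := @semigroup_strongly_continuous _ _ _ hT x.
move=> [d /= d0 dP]; exists d; split=> // t /andP[+ td].
rewrite le_eqVlt => /orP[/eqP <-|t0].
  by rewrite (semigroup_0 hT) subrr normr0.
by rewrite distrC; apply: dP => //=; rewrite sub0r normrN gtr0_norm.
Qed.

(** Uniform boundedness principle: operators [T (t n)] with [t n] tending to 0
    are pointwise bounded by strong continuity at 0. *)
Lemma semigroup_bounded_near0 : exists d M0 : R, [/\ 0 < d, 1 <= M0 &
  forall t, 0 <= t <= d -> forall x, `|T t x| <= M0 * `|x|].
Proof.
apply: contrapT => no.
have : forall n : nat, exists p : R * X, 0 <= p.1 <= n.+1%:R^-1 /\
    n.+1%:R * `|p.2| < `|T p.1 p.2|.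
  move=> n; apply: contrapT => nP; apply: no; exists n.+1%:R^-1, n.+1%:R.
  split; rewrite ?invr_gt0 ?ler1n// => t tn x.
  rewrite leNgt; apply/negP => lt; apply: nP; by exists (t, x).
move=> /choice[p pP].
pose t n := (p n).1; pose x n := (p n).2.
have t0 n : 0 <= t n by have [/andP[]] := pP n.
have tn n : t n <= n.+1%:R^-1 by have [/andP[]] := pP n.
pose F : set (X -> X) := [set f : X -> X | exists n, f = T (t n)].
have : uniform_bounded F.
  apply: Banach_Steinhauss => [_ [n ->]|y].
    split; last by move=> a y z; exact: linearP.
    have [M [M0 MP]] := continuous_linear_bound (semigroup_bounded hT (t0 n)).
    move=> r; exists (M * r) => y yr; apply: le_trans (MP y) _.
    by rewrite ler_wpM2l// ltW.
  have [d [d0 dP]] := semigroup_near0 y ltr01.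
  have [N _ NP] : \forall n \near \oo, n.+1%:R^-1 < d.
    exact: (near_infty_natSinv_lt (PosNum d0)).
  exists (`|y| + 1 + \sum_(k < N) `|T (t k) y|) => _ [n ->].
  have [nN|Nn] := ltnP n N.
    rewrite (bigD1 (Ordinal nN))//= addrCA lerDl addr_ge0//.
    by rewrite sumr_ge0.
  apply: le_trans (_ : `|y| + 1 <= _); last by rewrite lerDl sumr_ge0.
  have := dP (t n); rewrite t0 (le_lt_trans (tn n) (NP n Nn)) => /(_ isT) h.
  rewrite -[T (t n) y](subrK y) addrC; apply: le_trans (ler_normD _ _) _.
  by rewrite lerD2l ltW.
move=> /(_ 1)[M MP].
pose n := Num.truncn M.
have := pP n; rewrite -/(t n) -/(x n) => -[_ lt].
have xn0 : 0 < `|x n|.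
  rewrite normr_gt0; apply/eqP => x0.
  by move: lt; rewrite x0 linear0 !normr0 mulr0 ltxx.
have := MP (T (t n)) (ex_intro _ n erefl) (`|x n|^-1 *: x n).
rewrite linearZ !normrZ normfV normr_id mulVf ?gt_eqF// => /(_ (lexx _)).
rewrite leNgt => /negP; apply; rewrite ltr_pdivlMl//.
apply: le_lt_trans lt; rewrite mulrC ler_wpM2r// ltW//.
exact: real_truncnS_gt (num_real M).
Qed.

Lemma exists_growth_rate : exists w, growth_rate w.
Proof.
have [d [M0 [d0 M1 MP]]] := semigroup_bounded_near0.
have M0_gt0 : 0 < M0 := lt_le_trans ltr01 M1.
exists (ln M0 / d); apply: (growth_rate_step d0 MP) => x.
rewrite [d * _]mulrC divfK ?gt_eqF// lnK ?posrE//.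
by apply: MP; rewrite lexx ltW.
Qed.

Lemma growth_bound_ltNyr : (growth_bound T < +oo)%E.
Proof.
have [w /growth_bound_le gw] := exists_growth_rate.
exact: le_lt_trans gw (ltry _).
Qed.

Lemma semigroup_bounded_on (s : R) : 0 <= s -> exists M : R, 1 <= M /\
  forall t, 0 <= t <= s -> forall x, `|T t x| <= M * `|x|.
Proof.
move=> s0; have [w [M [M1 MP]]] := exists_growth_rate.
have M0 : 0 <= M := le_trans ler01 M1.
exists (M * expR (s * `|w|)); split.
  rewrite -[leLHS]mulr1 ler_pM//.
  by rewrite -expR0 ler_expR mulr_ge0.
move=> t /andP[t0 ts] x; apply: le_trans (MP t t0 x) _.
rewrite ler_wpM2r// ler_wpM2l// ler_expR.
apply: le_trans (_ : t * `|w| <= _); last by rewrite ler_wpM2r.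
by rewrite ler_wpM2l// ler_norm.
Qed.

End Growth.

(** * Neumann series and products of complete spaces *)

Section Neumann.
Context {R : realType} {Z : completeNormedModType R} (H : {linear Z -> Z}).
Variables (M q : R).
Hypotheses (q_itv : 0 <= q < 1) (HM : forall k z, `|iter k H z| <= M * q ^+ k * `|z|).

Lemma geometric_bound_continuous : continuous H.
Proof. by apply: (linear_bound_continuous (M := M * q ^+ 1)) => z; exact: (HM 1). Qed.

Lemma geometric_iter_cvg0 z : (fun k => iter k H z) @ \oo --> (0 : Z).
Proof.
have [q0 q1] := andP q_itv.
apply/cvgr0Pnorm_le => /= e e0.
have : `|z| * M * q ^+ k @[k --> \oo] --> (0 : R) by apply: cvg_geometric; rewrite ger0_norm.
move=> /cvgr0Pnorm_le/(_ e e0); apply: filterS => k; apply: le_trans.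
by apply: le_trans (HM k z) _; rewrite mulrAC [M * _]mulrC ler_norm.
Qed.

Lemma neumann_unique z : H z = z -> z = 0.
Proof.
move=> Hz; have it k : iter k H z = z by elim: k => //= k ->.
have := geometric_iter_cvg0 z; rewrite (funext it) => h.
by apply: (cvg_unique _ _ h) => //; exact: cvg_cst.
Qed.

Lemma neumann_partial z n :
  `|\sum_(0 <= k < n) iter k H z| <= M / (1 - q) * `|z|.
Proof.
have [q0 q1] := andP q_itv.
have [->|z0] := eqVneq z 0.
  have i0 k : iter k H 0 = 0 by elim: k => //= k ->; rewrite linear0.
  by under eq_bigr do rewrite i0; rewrite big1 ?normr0 ?mulr0.
have nz : 0 < `|z| by rewrite normr_gt0.
have M0 : 0 <= M.
  by have := le_trans (normr_ge0 _) (HM 0 z); rewrite expr0 mulr1 pmulr_lge0.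
apply: le_trans (ler_norm_sum _ _ _) _.
apply: le_trans (_ : \sum_(0 <= k < n) M * q ^+ k * `|z| <= _).
  by apply: ler_sum => k _; exact: HM.
rewrite -mulr_suml ler_wpM2r// -mulr_sumr ler_wpM2l//.
have q1' : 0 < 1 - q by rewrite subr_gt0.
rewrite big_mkord -[leRHS]mul1r ler_pdivlMr// mulrC -[1 - q]opprB mulNr -subrX1.
by rewrite opprB lerBlDr lerDl exprn_ge0.
Qed.

Lemma neumann_inverse : exists N : Z -> Z, (forall z, N z - H (N z) = z) /\
  forall z, `|N z| <= M / (1 - q) * `|z|.
Proof.
have [q0 q1] := andP q_itv.
pose u z : Z ^nat := fun k => iter k H z.
have cu z : cvg (series (u z) @ \oo).
  apply: normed_cvg; apply: (@series_le_cvg _ _ (geometric (M * `|z|) q)) => //.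
  - by move=> k /=.
  - move=> k; rewrite /geometric/= mulr_ge0 ?exprn_ge0//.
    by have := le_trans (normr_ge0 _) (HM 0 z); rewrite expr0 mulr1.
  - by move=> k; apply: le_trans (HM k z) _; rewrite /geometric/= mulrAC.
  - by apply: is_cvg_geometric_series; rewrite ger0_norm.
exists (fun z => lim (series (u z) @ \oo)); split=> z.
  have c1 := cu z.
  have c2 : (fun n => H (series (u z) n)) @ \oo --> H (lim (series (u z) @ \oo)).
    by apply: continuous_cvg => //; exact: geometric_bound_continuous.
  have c3 : (fun n => series (u z) n - H (series (u z) n)) @ \oo --> z - 0.
    have -> : (fun n => series (u z) n - H (series (u z) n)) = (fun n => z - iter n H z).
      apply/funext => n; rewrite /series /= linear_sum -sumrB.
      rewrite (telescope_sumr_eq (fun k => - iter k H z))//= ?opprK 1?addrC// => k _.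
      by rewrite opprK addrC.
    by apply: cvgB; [exact: cvg_cst|exact: geometric_iter_cvg0].
  rewrite subr0 in c3; apply: cvg_unique c3 => //; exact: cvgB.
have : `|series (u z) n| @[n --> \oo] --> `|lim (series (u z) @ \oo)|.
  by apply: cvg_norm; exact: cu.
move=> c; apply: (closed_cvg (fun r => r <= M / (1 - q) * `|z|) _ _ _ c); first exact: closed_le.
by near=> n; exact: neumann_partial.
Unshelve. all: by end_near. Qed.

Lemma neumann_bound (z : Z) : `|z| <= M / (1 - q) * `|z - H z|.
Proof.
have [N [NH Nb]] := neumann_inverse.
suff e : N (z - H z) = z by rewrite -{1}e; exact: Nb.
have := NH (z - H z); set y := N _ => yz.
apply/esym/eqP; rewrite -subr_eq0; apply/eqP/neumann_unique.
have -> : H (z - y) = H z - H y by rewrite linearB.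
transitivity (z - y - ((z - H z) - (y - H y))); first by module_eq R Z; ring.
by rewrite yz subrr subr0.
Qed.

End Neumann.

HB.instance Definition _ (X Y : puniformType) := Pointed.on (X * Y)%type.

Lemma prod_complete (R : realType) (X Y : completeNormedModType R)
    (F : set_system (X * Y)) : ProperFilter F -> cauchy F -> cvg F.
Proof.
move=> FF cF.
have /cauchyP cFe := cF.
have [x xF] : exists x : X, fst @ F --> x.
  apply/(@cvg_ex X); apply: cauchy_cvg; apply: cauchy_exP => e e0.
  have [z zF] := cFe e e0; exists z.1.
  by apply: (@filterS _ F) zF => w [].
have [y yF] : exists y : Y, snd @ F --> y.
  apply/(@cvg_ex Y); apply: cauchy_cvg; apply: cauchy_exP => e e0.
  have [z zF] := cFe e e0; exists z.2.
  by apply: (@filterS _ F) zF => w [].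
apply/cvg_ex; exists (x, y).
have -> : F = (fun w => (w.1, w.2)) @ F.
  by apply/seteqP; split=> A /=; rewrite nbhs_filterE; apply: filterS => -[].
exact: cvg_pair.
Qed.

HB.instance Definition _ (R : realType) (X Y : completeNormedModType R) :=
  Uniform_isComplete.Build (X * Y)%type (@prod_complete R X Y).

(** * The resolvent as a limit of Riemann sums *)

Lemma grid_above (R : realType) (h : R) (tau : nat -> R) : 0 <= h ->
  (forall n, 0 < tau n) -> tau @ \oo --> (0 : R) ->
  exists J : nat -> nat, (forall n, h <= (J n)%:R * tau n) /\
    (fun n => (J n)%:R * tau n) @ \oo --> h.
Proof.
move=> h0 tau0 tau_cvg; exists (fun n => (Num.truncn (h / tau n)).+1).
have itv n : h <= (Num.truncn (h / tau n)).+1%:R * tau n <= h + tau n.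
  have hn0 : 0 <= h / tau n by rewrite divr_ge0// ltW.
  have /andP[j1 j2] := truncn_itv hn0; apply/andP; split.
    by rewrite -ler_pdivrMr// ltW.
  by rewrite -natr1 mulrDl mul1r lerD2r -ler_pdivlMr.
split=> [n|]; first by have /andP[] := itv n.
apply: (@squeeze_cvgr _ _ _ _ (cst h) (fun n => h + tau n)).
- by near=> n; exact: itv.
- exact: cvg_cst.
- by rewrite -[X in _ --> X]addr0; apply: cvgD; [exact: cvg_cst|].
Unshelve. all: by end_near. Qed.

Section Laplace.
Context {R : realType} {Z : completeNormedModType R} (S : R -> {linear Z -> Z}).
Hypothesis hS : C0_semigroup S.
Variables (M e : R).
Hypotheses (M1 : 1 <= M) (e0 : 0 < e).
Hypothesis SM : forall t, 0 <= t -> forall z, `|S t z| <= M * expR (- (t * e)) * `|z|.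

Let M0 : 0 < M := lt_le_trans ltr01 M1.

Lemma decay_bound t z : 0 <= t -> `|S t z| <= M * `|z|.
Proof.
move=> t0; apply: le_trans (SM t0 z) _; rewrite ler_wpM2r//.
rewrite -[leRHS]mulr1 ler_wpM2l ?(ltW M0)// -expR0 ler_expR.
by rewrite oppr_le0 mulr_ge0// ltW.
Qed.

Lemma riemann_mean (tau eta : R) J (z : Z) : 0 <= tau ->
  (forall s, 0 <= s <= J%:R * tau -> `|S s z - z| <= eta) ->
  `|tau *: \sum_(0 <= k < J) S (k%:R * tau) z - (J%:R * tau) *: z| <= J%:R * tau * eta.
Proof.
move=> t0 near.
have -> : (J%:R * tau) *: z = tau *: \sum_(0 <= k < J) z.
  by rewrite mulrC -scalerA sumr_const_nat subn0 scaler_nat.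
rewrite -scalerBr -sumrB normrZ ger0_norm// [leRHS]mulrAC mulrC ler_wpM2r//.
apply: le_trans (ler_norm_sum _ _ _) _.
have -> : J%:R * eta = \sum_(0 <= k < J) eta by rewrite sumr_const_nat subn0 mulr_natl.
rewrite big_nat [leRHS]big_nat; apply: ler_sum => k /andP[_ kJ]; apply: near.
by rewrite mulr_ge0//= ler_wpM2r// ler_nat ltnW.
Qed.

Let q tau := expR (- (tau * e)).

Lemma step_q_itv tau : 0 < tau -> 0 <= q tau < 1.
Proof. by move=> t0; rewrite expR_ge0 -expR0 ltr_expR oppr_lt0 mulr_gt0. Qed.

Lemma step_iter_bound tau : 0 < tau ->
  forall k z, `|iter k (S tau) z| <= M * q tau ^+ k * `|z|.
Proof.
move=> t0 k z; rewrite -(semigroup_iter hS _ _ (ltW t0)).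
apply: le_trans (SM _ _) _; first by rewrite mulr_ge0// ltW.
by rewrite /q -expRM_natl mulrN mulrA.
Qed.

(** The bound [M / (1 - exp (- tau e))] of the Neumann series is of order
    [1 / tau] as [tau] tends to 0. *)
Lemma step_bound tau (z : Z) : 0 < tau <= 1 ->
  tau * `|z| <= M * (1 + e) / e * `|z - S tau z|.
Proof.
move=> /andP[t0 t1].
have zb := neumann_bound (step_q_itv t0) (step_iter_bound t0) z.
apply: le_trans (ler_wpM2l (ltW t0) zb) _; rewrite mulrA ler_wpM2r//.
have te0 : 0 < tau * e by rewrite mulr_gt0.
have q_le : q tau <= (1 + tau * e)^-1.
  rewrite /q expRN lef_pV2 ?posrE ?expR_gt0 ?expR_ge1Dx//.
  by rewrite addr_gt0.
have h : tau * e / (1 + tau * e) <= 1 - q tau.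
  apply: le_trans (_ : 1 - (1 + tau * e)^-1 <= _); last by rewrite lerB.
  by rewrite le_eqVlt; apply/orP; left; apply/eqP; field; rewrite gt_eqF// addr_gt0.
have q1 : 0 < 1 - q tau by rewrite subr_gt0; have /andP[] := step_q_itv t0.
have tq : tau <= (1 + e) / e * (1 - q tau).
  apply: le_trans (_ : (1 + e) / e * (tau * e / (1 + tau * e)) <= _); last first.
    by rewrite ler_wpM2l// divr_ge0 ?addr_ge0// ltW.
  have -> : (1 + e) / e * (tau * e / (1 + tau * e)) = tau * ((1 + e) / (1 + tau * e)).
    by field; rewrite !gt_eqF// addr_gt0.
  rewrite -[leLHS]mulr1 ler_wpM2l ?(ltW t0)// ler_pdivlMr ?addr_gt0// mul1r.
  by rewrite lerD2l -[leRHS]mul1r ler_wpM2r// ltW.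
rewrite mulrCA -!mulrA ler_wpM2l ?(ltW M0)// ler_pdivrMr//.
Qed.

Lemma fixed_point_eq0 tau (z : Z) : 0 < tau <= 1 -> S tau z = z -> z = 0.
Proof.
move=> tt Sz; have := step_bound z tt; have /andP[t0 _] := tt.
rewrite Sz subrr normr0 mulr0 pmulr_rle0// normr_le0 => /eqP//.
Qed.

Lemma step_surjective tau (z : Z) : 0 < tau -> exists y, y - S tau y = tau *: z.
Proof.
move=> t0; have [N [NS _]] := neumann_inverse (step_q_itv t0) (step_iter_bound t0).
by exists (N (tau *: z)).
Qed.

Lemma step_telescope tau (z y : Z) J : 0 <= tau -> y - S tau y = tau *: z ->
  y - S (J%:R * tau) y = tau *: \sum_(0 <= k < J) S (k%:R * tau) z.
Proof.
move=> t0 yz; rewrite scaler_sumr.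
rewrite (@telescope_sumr_eq _ 0 J (fun k => - S (k%:R * tau) y))// => [|k _].
  by rewrite mul0r (semigroup_0 hS) opprK addrC.
rewrite opprK addrC -linearZ_LR -yz linearB/=; congr (_ - _).
by rewrite -(semigroup_add hS) ?mulr_ge0// -natr1 mulrDl mul1r.
Qed.

Let tau (n : nat) : R := 2^-1 ^+ n.

Lemma tau_itv n : 0 < tau n <= 1.
Proof. by rewrite exprn_gt0//= exprn_ile1//; lra. Qed.

Lemma tau_cvg0 : tau @ \oo --> (0 : R).
Proof. by apply: cvg_expr; rewrite ger0_norm//; lra. Qed.

(** [D n z] is the Riemann sum of step [tau n] of the Laplace transform of the
    orbit of [z]. Two such sums differ by [(1 - S (tau n))^-1] applied to the
    error of a Riemann sum on an interval of length [tau n]. This error is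
    [o (tau n)] by strong continuity, and the inverse is [O (1 / tau n)]. *)
Lemma riemann_resolvent_cvg : exists D : nat -> Z -> Z, exists L : Z -> Z,
  (forall n z, D n z - S (tau n) (D n z) = tau n *: z) /\
  (forall z, D ^~ z @ \oo --> L z).
Proof.
have /choice[D DP] : forall n, exists D : Z -> Z,
    forall z, D z - S (tau n) (D z) = tau n *: z.
  move=> n; have /andP[t0 _] := tau_itv n.
  by have /choice[D DP] := fun z => step_surjective z t0; exists D.
exists D.
suff /choice[L LP] : forall z, exists l : Z, D ^~ z @ \oo --> l by exists L.
move=> z; apply/(@cvg_ex Z); apply: cauchy_cvg; apply: cauchy_exP => eps eps0.
pose B := M * (1 + e) / e.
have B0 : 0 < B by rewrite divr_gt0// mulr_gt0// addr_gt0.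
have [d [d0 dP]] := semigroup_near0 hS z (divr_gt0 eps0 (mulr_gt0 (ltr0n _ 2) B0)).
have /cvgr0Pnorm_lt/(_ _ d0)[n _ nd] := tau_cvg0.
exists (D n z); exists n => // m /= nm; rewrite -ball_normE/= distrC.
have tn := tau_itv n; have tm := tau_itv m.
have tnm : tau n = (2 ^ (m - n))%N%:R * tau m.
  rewrite /tau -{2}(subnKC nm) exprD natrX mulrCA -exprMn mulfV// expr1n mulr1//.
have m0 : 0 <= tau m by rewrite ltW//; case/andP: tm.
have key := step_telescope (2 ^ (m - n)) m0 (DP m z); rewrite -tnm in key.
have := step_bound (D m z - D n z) tn; rewrite -/B linearB/=.
have -> : D m z - D n z - (S (tau n) (D m z) - S (tau n) (D n z)) =
    (D m z - S (tau n) (D m z)) - (D n z - S (tau n) (D n z)) by module_eq R Z; ring.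
rewrite DP key => h.
have /andP[tn0 _] := tn.
have mean := @riemann_mean (tau m) (eps / (2 * B)) (2 ^ (m - n)) z m0; rewrite -tnm in mean.
rewrite -(ltr_pM2l tn0); apply: le_lt_trans h _.
apply: le_lt_trans (_ : B * (tau n * (eps / (2 * B))) < _).
  rewrite ler_wpM2l ?(ltW B0)//; apply: mean => s /andP[s0 sn]; apply: ltW; apply: dP.
  rewrite s0/= (le_lt_trans sn)//; have := nd n (leqnn n).
  by rewrite ger0_norm// ltW.
have -> : B * (tau n * (eps / (2 * B))) = tau n * (eps / 2) by field; rewrite gt_eqF.
by rewrite ltr_pM2l//; lra.
Qed.

Lemma semigroup_comm s t z : 0 <= s -> 0 <= t -> S s (S t z) = S t (S s z).
Proof. by move=> s0 t0; rewrite -!(semigroup_add hS)// addrC. Qed.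

Lemma semigroup_cvg_above h (u : nat -> R) z : 0 <= h -> (forall n, h <= u n) ->
  u @ \oo --> h -> (fun n => S (u n) z) @ \oo --> S h z.
Proof.
move=> h0 hu uh.
have -> : (fun n => S (u n) z) = (fun n => S h (S (u n - h) z)).
  by apply/funext => n; rewrite -(semigroup_add hS) ?subr_ge0// subrKC.
apply: continuous_cvg; first exact: semigroup_bounded hS _ h0 _.
apply/cvgrPdist_lt => e' e'0; have [d [d0 dP]] := semigroup_near0 hS z e'0.
have /cvgrPdist_lt/(_ _ d0) := uh; apply: filterS => n un.
rewrite distrC; apply: dP; rewrite subr_ge0 hu/= (le_lt_trans _ un)// distrC.
exact: ler_norm.
Qed.

(** [L] is the inverse of the opposite of the generator. Telescoping the Riemann
    sums up to [h] shows that [L z - S h (L z)] is [h z] up to [o (h)]; the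
    limit is taken along grid points that decrease to [h], where right
    continuity of the orbits suffices. *)
Lemma laplace_resolvent : exists L : {linear Z -> Z}, [/\ continuous L,
  forall z, h^-1 *: (S h (L z) - L z) @[h --> 0^'+] --> - z &
  forall t z, 0 <= t -> L (S t z) = S t (L z)].
Proof.
have [D [L0 [DP DL]]] := riemann_resolvent_cvg.
have Duniq n z y : y - S (tau n) y = tau n *: z -> y = D n z.
  move=> yz; apply/eqP; rewrite -subr_eq0; apply/eqP/(fixed_point_eq0 (tau_itv n)).
  have -> : S (tau n) (y - D n z) = S (tau n) y - S (tau n) (D n z) by rewrite linearB.
  transitivity (y - D n z - ((y - S (tau n) y) - (D n z - S (tau n) (D n z)))).
    by module_eq R Z; ring.
  by rewrite yz DP subrr subr0.
have Dlin n a z w : D n (a *: z + w) = a *: D n z + D n w.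
  apply/esym/Duniq.
  have -> : S (tau n) (a *: D n z + D n w) = a *: S (tau n) (D n z) + S (tau n) (D n w).
    by rewrite linearP.
  rewrite scalerDr scalerA [tau n * a]mulrC -scalerA -!DP.
  by module_eq R Z; ring.
have L0lin : linear L0.
  move=> a z w; apply: (cvg_unique _ (DL (a *: z + w))) => //.
  have -> : D ^~ (a *: z + w) = (fun n => a *: D n z + D n w).
    by apply/funext => n; exact: Dlin.
  apply: cvgD; last exact: DL.
  by apply: cvgZr; exact: DL.
pose L : {linear Z -> Z} := HB.pack L0 (GRing.isLinear.Build R Z Z *:%R L0 L0lin).
pose B := M * (1 + e) / e.
have Dbound n z : `|D n z| <= B * `|z|.
  have tn := tau_itv n; have /andP[t0 _] := tn.
  have := step_bound (D n z) tn; rewrite DP normrZ gtr0_norm// mulrCA.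
  by rewrite ler_pM2l.
exists L; split.
- apply: (@linear_bound_continuous _ _ _ L B) => z.
  have nD : (fun n => `|D n z|) @ \oo --> `|L0 z| by apply: cvg_norm; exact: DL.
  apply: (closed_cvg (fun r => r <= B * `|z|) _ _ _ nD); first exact: closed_le.
  by near=> n; exact: Dbound.
- move=> z; apply/cvgrPdist_le => eta eta0.
  have [d [d0 dP]] := semigroup_near0 hS z eta0.
  exists d => //= h /=; rewrite sub0r normrN => hd h0.
  rewrite gtr0_norm// in hd.
  have tau0 n : 0 < tau n by have /andP[] := tau_itv n.
  have [J [h_le hn_cvg]] := grid_above (ltW h0) tau0 tau_cvg0.
  pose hn n := (J n)%:R * tau n.
  have hn0 n : 0 <= hn n by apply: le_trans (h_le n); exact: ltW.
  have SD : (fun n => S (hn n) (D n z)) @ \oo --> S h (L0 z).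
    have -> : (fun n => S (hn n) (D n z)) =
        (fun n => S (hn n) (D n z - L0 z) + S (hn n) (L0 z)).
      by apply/funext => n; rewrite -linearD subrK.
    rewrite -[S h (L0 z)]add0r; apply: cvgD; last first.
      by apply: semigroup_cvg_above => //; exact: ltW.
    apply/cvgr0Pnorm_lt => r r0.
    have rM : 0 < r / M by rewrite divr_gt0.
    have /cvgrPdist_lt/(_ _ rM) := DL z; apply: filterS => n.
    rewrite distrC ltr_pdivlMr// mulrC; apply: le_lt_trans.
    exact: decay_bound.
  pose g n := hn n * eta - `|D n z - S (hn n) (D n z) - hn n *: z|.
  have gl : g @ \oo --> h * eta - `|L0 z - S h (L0 z) - h *: z|.
    apply: cvgB; first exact: cvgMl.
    by apply: cvg_norm; apply: cvgB; [apply: cvgB => //; exact: DL|exact: cvgZl].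
  have : 0 <= h * eta - `|L0 z - S h (L0 z) - h *: z|.
    apply: (@closed_cvg _ R^o \oo _ g (fun r : R => 0 <= r) _ _ _ gl); first exact: closed_ge.
    have /cvgr_lt/(_ _ hd) := hn_cvg; apply: filterS => n hnd.
    rewrite subr_ge0 (step_telescope _ (ltW (tau0 n)) (DP n z)).
    apply: riemann_mean; first exact: ltW.
    move=> s /andP[s0 sn]; apply: ltW; apply: dP; rewrite s0/=.
    exact: le_lt_trans hnd.
  rewrite subr_ge0 => le.
  have -> : - z - h^-1 *: (S h (L z) - L z) = h^-1 *: (L0 z - S h (L0 z) - h *: z).
    rewrite -[L z]/(L0 z); module_eq R Z; field; rewrite ?gt_eqF//.
  by rewrite normrZ gtr0_norm ?invr_gt0// ler_pdivrMl.
- move=> t z t0; apply: (cvg_unique _ (DL (S t z))) => //.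
  have -> : D ^~ (S t z) = (fun n => S t (D n z)).
    apply/funext => n; apply/esym/Duniq; have /andP[/ltW tn _] := tau_itv n.
    rewrite semigroup_comm// -[RHS]linearZ_LR -DP.
    by rewrite linearB.
  apply: continuous_cvg; last exact: DL.
  exact: semigroup_bounded hS _ t0 _.
Unshelve. all: by end_near. Qed.

End Laplace.

(** * The complexified generator *)

Section Derivatives.
Variable (R : realType).

Lemma is_derive_at_right (f : R -> R) (df : R) : is_derive (0 : R) 1 f df ->
  h^-1 * (f h - f 0) @[h --> (0:R)^'+] --> df.
Proof.
move=> [fd <-]; have := cvg_dnbhs_at_right fd; apply: cvg_trans.
apply: near_eq_cvg; near=> h.
by rewrite /= addr0 [h *: _]mulr1.
Unshelve. all: by end_near. Qed.

Variables (a b : R).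

Lemma expR_cos_right :
  h^-1 * (expR (h * a) * cos (h * b) - 1) @[h --> (0:R)^'+] --> a.
Proof.
have D : is_derive (0 : R) 1 (fun h : R => expR (h * a) * cos (h * b)) a.
  apply: is_derive_eq; rewrite !mul0r cos0 expR0 sin0/=.
  by rewrite /GRing.scale/=; ring.
by have := is_derive_at_right D; rewrite !mul0r cos0 expR0 mulr1.
Qed.

Lemma expR_sin_right :
  h^-1 * (expR (h * a) * sin (h * b)) @[h --> (0:R)^'+] --> b.
Proof.
have D : is_derive (0 : R) 1 (fun h : R => expR (h * a) * sin (h * b)) b.
  apply: is_derive_eq; rewrite !mul0r cos0 expR0 sin0/=.
  by rewrite /GRing.scale/=; ring.
have := is_derive_at_right D; rewrite !mul0r sin0 mulr0.
by under [X in X @ _ --> _ -> _]funext do rewrite subr0.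
Qed.

End Derivatives.

Lemma quotient_cvg_cvg0 (R : realType) (V : normedModType R) (f : R -> V) (l : V) :
  h^-1 *: f h @[h --> (0:R)^'+] --> l -> f h @[h --> (0:R)^'+] --> 0.
Proof.
move=> fl; have : h *: (h^-1 *: f h) @[h --> (0:R)^'+] --> (0 : R) *: l.
  by apply: cvgZ => //; apply: cvg_at_right_filter; exact: cvg_id.
rewrite scale0r; apply: cvg_trans; apply: near_eq_cvg; near=> h.
rewrite scalerA mulfV ?scale1r//.
Unshelve. all: by end_near. Qed.

Section Rotated.
Context {R : realType} {X : completeNormedModType R} (T : R -> {linear X -> X}).
Hypothesis hT : C0_semigroup T.
Variables (a b : R).

Local Notation c t := (expR (t * - a) * cos (t * b)).
Local Notation s t := (expR (t * - a) * sin (t * b)).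

(** The complexification of [exp (- t (a + i b)) T t]. *)
Definition rotated (t : R) (z : X * X) : X * X :=
  (c t *: T t z.1 + s t *: T t z.2, c t *: T t z.2 - s t *: T t z.1).

Lemma rotated_linear t : linear (rotated t).
Proof.
move=> k z w; rewrite /rotated; congr pair => /=; rewrite !linearP/=.
  by module_eq R X; ring.
by module_eq R X; ring.
Qed.
HB.instance Definition _ t :=
  GRing.isLinear.Build R (X * X)%type (X * X)%type *:%R (rotated t) (rotated_linear t).

Definition rotated_semigroup (t : R) : {linear (X * X)%type -> (X * X)%type} :=
  rotated t.

Lemma rotated_add t r z : 0 <= t -> 0 <= r ->
  rotated (t + r) z = rotated t (rotated r z).
Proof.
move=> t0 r0; rewrite /rotated/= !(semigroup_add hT t0 r0) !mulrDl !expRD cosD sinD.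
congr pair.
  rewrite !(linearD (T t)) !(linearN (T t)) !(linearZ_LR (T t)).
  by module_eq R X; ring.
rewrite !(linearD (T t)) !(linearN (T t)) !(linearZ_LR (T t)).
by module_eq R X; ring.
Qed.

Lemma rotated_bound (M w : R) : 1 <= M ->
  (forall t, 0 <= t -> forall x, `|T t x| <= M * expR (t * w) * `|x|) ->
  forall t, 0 <= t -> forall z, `|rotated t z| <= 2 * M * expR (- (t * (a - w))) * `|z|.
Proof.
move=> M1 MT t t0 z.
have z1 : `|z.1| <= `|z| by rewrite prod_normE le_max lexx.
have z2 : `|z.2| <= `|z| by rewrite prod_normE le_max lexx orbT.
have M0 : 0 <= M := le_trans ler01 M1.
have term (k : R) x : `|k| <= 1 -> `|x| <= `|z| ->
    `|(expR (t * - a) * k) *: T t x| <= M * expR (- (t * (a - w))) * `|z|.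
  move=> k1 xz; rewrite normrZ normrM gtr0_norm ?expR_gt0//.
  apply: le_trans (_ : expR (t * - a) * (M * expR (t * w) * `|x|) <= _).
    apply: ler_pM => //.
      by rewrite -[leRHS]mulr1 ler_wpM2l// expR_ge0.
    exact: MT.
  have -> : - (t * (a - w)) = t * - a + t * w by ring.
  rewrite expRD mulrA mulrCA !mulrA ler_wpM2l//.
  by rewrite !mulr_ge0// expR_ge0.
rewrite prod_normE ge_max; apply/andP; split.
  apply: le_trans (ler_normD _ _) _; rewrite -!mulrA mulrDl mul1r mulrA.
  by apply: lerD; apply: term => //; [exact: cos_max|exact: sin_max].
apply: le_trans (ler_normB _ _) _; rewrite -!mulrA mulrDl mul1r mulrA.
by apply: lerD; apply: term => //; [exact: cos_max|exact: sin_max].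
Qed.

Lemma cvg_cs : c h @[h --> (0:R)^'+] --> (1:R) /\ s h @[h --> (0:R)^'+] --> (0:R).
Proof.
split; last exact: (@quotient_cvg_cvg0 R R^o _ _ (@expR_sin_right R (- a) b)).
have := @quotient_cvg_cvg0 R R^o _ _ (@expR_cos_right R (- a) b) => h1.
have -> : (fun h => c h) = (fun h => (c h - 1) + 1) by apply/funext => h; rewrite subrK.
by rewrite -[X in _ --> X]add0r; apply: cvgD => //; exact: cvg_cst.
Qed.

Lemma rotated_C0 : C0_semigroup rotated_semigroup.
Proof.
have [w [M [M1 MT]]] := exists_growth_rate hT.
split.
- move=> t t0; apply: (@linear_bound_continuous _ _ _ _ (2 * M * expR (- (t * (a - w))))).
  exact: rotated_bound.
- move=> [x y]; rewrite /rotated_semigroup/= /rotated/= !(semigroup_0 hT) !mul0r.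
  by rewrite expR0 cos0 sin0 mulr0 !mulr1 !scale1r !scale0r addr0 subr0.
- by move=> t r t0 r0 z; exact: rotated_add.
- move=> [x y]; have [c1 s0] := cvg_cs.
  have Tx := @semigroup_strongly_continuous _ _ _ hT x.
  have Ty := @semigroup_strongly_continuous _ _ _ hT y.
  have e : (x, y) = ((1 : R) *: x + (0 : R) *: y, (1 : R) *: y - (0 : R) *: x).
    by rewrite !scale1r !scale0r addr0 subr0.
  rewrite [X in _ --> X]e; apply: cvg_pair; first exact: (cvgD (cvgZ c1 Tx) (cvgZ s0 Ty)).
  exact: (cvgB (cvgZ c1 Ty) (cvgZ s0 Tx)).
Qed.

(** Product rule: the rotation adds [- (a + i b)] to the complexified generator. *)
Lemma rotated_derivative (x y x' y' : X) :
  h^-1 *: (T h x - x) @[h --> (0:R)^'+] --> x' ->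
  h^-1 *: (T h y - y) @[h --> (0:R)^'+] --> y' ->
  h^-1 *: (rotated h (x, y) - (x, y)) @[h --> (0:R)^'+] -->
    (x' - a *: x + b *: y, y' - a *: y - b *: x).
Proof.
move=> xx' yy'; have [c1 s0] := cvg_cs.
have dc := @expR_cos_right R (- a) b; have ds := @expR_sin_right R (- a) b.
have -> : (fun h => h^-1 *: (rotated h (x, y) - (x, y))) = (fun h =>
    (c h *: (h^-1 *: (T h x - x)) + s h *: (h^-1 *: (T h y - y)) +
       ((h^-1 * (c h - 1)) *: x + (h^-1 * s h) *: y),
     c h *: (h^-1 *: (T h y - y)) - s h *: (h^-1 *: (T h x - x)) +
       ((h^-1 * (c h - 1)) *: y - (h^-1 * s h) *: x))).
  apply/funext => h; congr pair => /=; module_eq R X; ring.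
have -> : (x' - a *: x + b *: y, y' - a *: y - b *: x) =
   ((1 : R) *: x' + (0 : R) *: y' + ((- a) *: x + b *: y),
    (1 : R) *: y' - (0 : R) *: x' + ((- a) *: y - b *: x)).
  by congr pair; module_eq R X; ring.
apply: cvg_pair.
  apply: cvgD; first exact: (cvgD (cvgZ c1 xx') (cvgZ s0 yy')).
  exact: (cvgD (cvgZr_tmp dc) (cvgZr_tmp ds)).
apply: cvgD; first exact: (cvgB (cvgZ c1 yy') (cvgZ s0 xx')).
exact: (cvgB (cvgZr_tmp dc) (cvgZr_tmp ds)).
Qed.

(** Product rule for the rotation in the opposite direction. *)
Lemma rotated_derivative_inv (x y p q : X) :
  h^-1 *: (rotated h (x, y) - (x, y)) @[h --> (0:R)^'+] --> (p, q) ->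
  h^-1 *: (T h x - x) @[h --> (0:R)^'+] --> p + a *: x - b *: y /\
  h^-1 *: (T h y - y) @[h --> (0:R)^'+] --> q + a *: y + b *: x.
Proof.
move=> pq.
have fp : h^-1 *: ((rotated h (x, y)).1 - x) @[h --> (0:R)^'+] --> p.
  by have := cvg_comp _ _ pq (@cvg_fst _ _ _ _ _); apply.
have fq : h^-1 *: ((rotated h (x, y)).2 - y) @[h --> (0:R)^'+] --> q.
  by have := cvg_comp _ _ pq (@cvg_snd _ _ _ _ _); apply.
have dc := @expR_cos_right R a b; have ds := @expR_sin_right R a b.
have s0 := @quotient_cvg_cvg0 R R^o _ _ ds.
have c1 : expR (h * a) * cos (h * b) @[h --> (0:R)^'+] --> (1 : R).
  have -> : (fun h => expR (h * a) * cos (h * b)) =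
    (fun h => (expR (h * a) * cos (h * b) - 1) + 1) by apply/funext => h; rewrite subrK.
  rewrite -[X in _ --> X]add0r; apply: cvgD; last exact: cvg_cst.
  exact: (@quotient_cvg_cvg0 R R^o _ _ dc).
have id1 h : expR (h * a) * cos (h * b) * c h + expR (h * a) * sin (h * b) * s h = 1.
  transitivity (expR (h * a) * expR (h * - a) * (cos (h * b) ^+ 2 + sin (h * b) ^+ 2)).
    by ring.
  by rewrite cos2Dsin2 mulr1 -expRD mulrN subrr expR0.
have TP h : T h x = (expR (h * a) * cos (h * b)) *: (rotated h (x, y)).1 -
    (expR (h * a) * sin (h * b)) *: (rotated h (x, y)).2.
  by rewrite -[LHS]scale1r -(id1 h) /rotated/=; module_eq R X; ring.
have TQ h : T h y = (expR (h * a) * cos (h * b)) *: (rotated h (x, y)).2 +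
    (expR (h * a) * sin (h * b)) *: (rotated h (x, y)).1.
  by rewrite -[LHS]scale1r -(id1 h) /rotated/=; module_eq R X; ring.
split.
  have -> : (fun h => h^-1 *: (T h x - x)) = (fun h =>
      (expR (h * a) * cos (h * b)) *: (h^-1 *: ((rotated h (x, y)).1 - x)) -
      (expR (h * a) * sin (h * b)) *: (h^-1 *: ((rotated h (x, y)).2 - y)) +
      ((h^-1 * (expR (h * a) * cos (h * b) - 1)) *: x -
       (h^-1 * (expR (h * a) * sin (h * b))) *: y)).
    by apply/funext => h; rewrite (TP h); module_eq R X; ring.
  have -> : p + a *: x - b *: y = (1 : R) *: p - (0 : R) *: q + (a *: x - b *: y).
    by rewrite scale1r scale0r subr0 addrA.
  apply: cvgD; first exact: (cvgB (cvgZ c1 fp) (cvgZ s0 fq)).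
  exact: (cvgB (cvgZr_tmp dc) (cvgZr_tmp ds)).
have -> : (fun h => h^-1 *: (T h y - y)) = (fun h =>
    (expR (h * a) * cos (h * b)) *: (h^-1 *: ((rotated h (x, y)).2 - y)) +
    (expR (h * a) * sin (h * b)) *: (h^-1 *: ((rotated h (x, y)).1 - x)) +
    ((h^-1 * (expR (h * a) * cos (h * b) - 1)) *: y +
     (h^-1 * (expR (h * a) * sin (h * b))) *: x)).
  by apply/funext => h; rewrite (TQ h); module_eq R X; ring.
have -> : q + a *: y + b *: x = (1 : R) *: q + (0 : R) *: p + (a *: y + b *: x).
  by rewrite scale1r scale0r addr0 addrA.
apply: cvgD; first exact: (cvgD (cvgZ c1 fq) (cvgZ s0 fp)).
exact: (cvgD (cvgZr_tmp dc) (cvgZr_tmp ds)).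
Qed.

End Rotated.

(** The rotated semigroup decays exponentially, and its generator is the
    complexified generator minus [l]. *)
Lemma growth_rate_resolvent (R : realType) (X : completeNormedModType R)
    (T : R -> {linear X -> X}) (w : R) (l : R[i]) :
  C0_semigroup T -> growth_rate T w -> w < complex.Re l ->
  resolvent_set (complexified_operator (generator T)) l.
Proof.
move=> hT [M [M1 MT]]; case: l => a b /= wa.
have hS := rotated_C0 hT a b.
have M2 : 1 <= 2 * M by lra.
have aw : 0 < a - w by rewrite subr_gt0.
have [L [Lcont Lder Lcomm]] := laplace_resolvent hS M2 aw (rotated_bound a b M1 MT).
have gen x y : h^-1 *: (T h x - x) @[h --> (0:R)^'+] --> y ->
    udom (generator T) x /\ uop (generator T) x = y.
  move=> xy; split; first by apply/cvg_ex; exists y.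
  exact: cvg_lim xy.
exists L; split.
- exact: Lcont.
- move=> [z1 z2].
  have := Lder (z1, z2); case: (L (z1, z2)) => y1 y2 h.
  have [/gen[d1 e1] /gen[d2 e2]] := rotated_derivative_inv h.
  split; first by split.
  rewrite (congr2 pair e1 e2 : uop (complexified_operator (generator T)) (y1, y2) = _).
  by congr pair; rewrite /=; module_eq R X; ring.
- move=> [x1 x2] [/= d1 d2].
  have := rotated_derivative (T := T) (a := a) (b := b) d1 d2; rewrite -/(uop (generator T) x1).
  rewrite -/(uop (generator T) x2) => h.
  set r := (X in L X).
  have -> : L r = - L (- r) by rewrite linearN opprK.
  have Er : - r = (uop (generator T) x1 - a *: x1 + b *: x2,
                   uop (generator T) x2 - a *: x2 - b *: x1).
    by rewrite /r; congr pair; rewrite /=; module_eq R X; ring.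
  rewrite -Er in h.
  have Lh : (fun h => L (h^-1 *: (rotated T a b h (x1, x2) - (x1, x2)))) @ (0:R)^'+ --> L (- r).
    by apply: continuous_cvg h; exact: Lcont.
  suff -> : L (- r) = - (x1, x2) by rewrite opprK.
  apply: (cvg_unique _ Lh) => //.
  apply: cvg_trans (Lder (x1, x2)); apply: near_eq_cvg; near=> t.
  have t0 : 0 <= t by near: t; exact: nbhs_right_ge.
  by rewrite linearZ_LR -(Lcomm t _ t0) -linearB.
Unshelve. all: by end_near. Qed.

(** * Positive semigroups of growth bound zero *)

Section NormalisedSemigroup.
Context {R : realType} {X : completeNormedModType R} (C : set X).
Hypothesis hC : ordered_banach_cone C.
Variable S : R -> {linear X -> X}.
Hypotheses (hS : C0_semigroup S) (posS : positive_semigroup C S).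
Variable s0 : R.
Hypotheses (s0_gt0 : 0 < s0) (cG : compact_operator (S s0)).
Hypotheses (rate_up : forall e, 0 < e -> growth_rate S e)
  (rate_low : forall e, 0 < e -> ~ growth_rate S (- e)).
Variables (u : X) (u' : {linear X -> R^o}).
Hypotheses (hu : almost_interior C u) (hu' : strictly_positive C u').

Let ctG : continuous (S s0) := semigroup_bounded hS (ltW s0_gt0).
Let posS' t x : 0 <= t -> C x -> C (S t x).
Proof. by move=> t0 Cx; apply: (posS t0); exists x. Qed.
Let posG x : C x -> C (S s0 x) := posS' (ltW s0_gt0).
Let Cu : C u := hu.1.
Let u'_ge0 x : C x -> 0 <= u' x := hu'.1.2 x.
Let u'_cont : continuous u' := hu'.1.1.

(** A power that halves the norm yields a negative growth rate. *)
Lemma no_iter_contraction m : ~ (forall x, `|iter m (S s0) x| <= 2^-1 * `|x|).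
Proof.
move=> half; have [m0|m0] := posnP m.
  apply: (rate_low ltr01); exists 1; split=> // t t0 x.
  (* the identity halves the norm only on the zero space *)
  have x0 (y : X) : y = 0.
    have := half y; rewrite m0/= => h; apply/eqP; rewrite -normr_le0.
    have := normr_ge0 y; lra.
  by rewrite (x0 (S t x)) normr0 !mulr_ge0// expR_ge0.
pose s := m%:R * s0; have s_gt0 : 0 < s by rewrite mulr_gt0// ltr0n.
have ln2 : 0 < ln 2 :> R by rewrite ln_gt0// ltr1n.
apply: (rate_low (divr_gt0 ln2 s_gt0)).
have [M [M1 MP]] := semigroup_bounded_on hS (ltW s_gt0).
apply: (growth_rate_step hS s_gt0 MP) => x.
rewrite semigroup_iter ?(ltW s0_gt0)// mulrN [s * _]mulrC divfK ?gt_eqF// expRN lnK ?posrE//.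
Qed.

Lemma orbit_not_vanishing :
  ~ ((fun m => u' (iter m (S s0) u) : R) @ \oo --> (0 : R)).
Proof.
move=> /(orbit_decay_norm_decay hC cG ctG posG hu hu')[m].
exact: no_iter_contraction.
Qed.

Lemma resolvent_vector (l : R) : 1 < l -> exists y, C y /\ y - l^-1 *: S s0 y = u.
Proof.
move=> l1; have l0 : 0 < l := lt_trans ltr01 l1.
have ln0 : 0 < ln l by rewrite ln_gt0.
have e0 : 0 < ln l / (2 * s0) by rewrite divr_gt0// mulr_gt0.
have [M [M1 MS]] := rate_up e0.
pose H : {linear X -> X} := l^-1 \*: S s0.
have itH k z : iter k H z = (l ^+ k)^-1 *: iter k (S s0) z.
  elim: k => [|k IH]; first by rewrite expr0 invr1 scale1r.
  by rewrite !iterS IH /H/= linearZ/= scalerA exprS invfM.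
pose q := expR (ln l / 2) / l.
have q_itv : 0 <= q < 1.
  rewrite divr_ge0 ?expR_ge0 ?(ltW l0)//= ltr_pdivrMr// mul1r -[ltRHS]lnK ?posrE//.
  by rewrite ltr_expR; lra.
have HM k z : `|iter k H z| <= M * q ^+ k * `|z|.
  rewrite itH normrZ gtr0_norm ?invr_gt0 ?exprn_gt0//.
  rewrite -semigroup_iter ?(ltW s0_gt0)//.
  have := MS (k%:R * s0) ltac:(by rewrite mulr_ge0// ltW) z.
  have -> : k%:R * s0 * (ln l / (2 * s0)) = k%:R * (ln l / 2) by field; rewrite gt_eqF.
  rewrite expRM_natl /q expr_div_n => h.
  rewrite ler_pdivrMl ?exprn_gt0//; apply: le_trans h _.
  rewrite le_eqVlt; apply/orP; left; apply/eqP; field.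
  by rewrite gt_eqF// exprn_gt0.
have [N [NH _]] := neumann_inverse q_itv HM.
exists (N u); split; last by have := NH u.
set y := N u.
have yE n : y - iter n H y = \sum_(0 <= k < n) iter k H u.
  rewrite (@telescope_sumr_eq _ 0 n (fun k => - iter k H y))//.
    by rewrite opprK addrC.
  move=> k _; rewrite opprK addrC iterSr -iter_linearB.
  by rewrite /y NH.
have ycvg : (fun n => y - iter n H y) @ \oo --> y.
  rewrite -[X in _ --> X]subr0; apply: cvgB; first exact: cvg_cst.
  exact: geometric_iter_cvg0 q_itv HM _.
apply: (closed_cvg C (cone_closed hC) _ _ ycvg); near=> n; rewrite yE.
apply: big_ind; first exact: cone0 hC.
  exact: cone_add hC.
move=> k _; rewrite itH; apply: (cone_scale hC); last exact: iter_pos.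
by rewrite invr_ge0 exprn_ge0// ltW.
Unshelve. all: by end_near. Qed.

(** As [l] decreases to 1, the vectors of [resolvent_vector] do not stay bounded
    along the ultrafilter: otherwise their limit [w = u + S s0 w] would bound
    the partial sums of [u' (iter k (S s0) u)], whose terms do not tend to 0.
    Once normalised, these unbounded vectors are almost fixed by the compact
    operator [S s0], and they converge to a fixed vector. *)
Lemma krein_rutman : exists v, [/\ C v, v != 0 & S s0 v = v].
Proof.
pose l n : R := 1 + n.+1%:R^-1.
have l1 n : 1 < l n by rewrite ltrDl invr_gt0.
have [U [UU Uoo]] := ultra_eventually.
have lU : l @ U --> (1 : R).
  rewrite -[X in _ --> X]addr0; apply: cvgD; first exact: cvg_cst.
  by apply: cvg_trans (@cvg_harmonic R); exact: cvg_app.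
have lVU : (fun n => (l n)^-1) @ U --> (1 : R).
  by rewrite -invr1; apply: cvgV => //; exact: oner_neq0.
have /choice[y yP] := fun n => resolvent_vector (l1 n).
have Cy n : C (y n) by have [] := yP n.
have yE n : y n = u + (l n)^-1 *: S s0 (y n) by have [_ <-] := yP n; rewrite subrK.
have [[B UB]|unb] := pselect (exists B, U [set n | `|y n| <= B]).
  exfalso; apply: orbit_not_vanishing.
  pose z n := if `|y n| <= B then y n else 0.
  have zB n : `|z n| <= Num.max B 0.
    by rewrite /z; case: ifPn => [h|_]; rewrite le_max ?h// normr0 lexx orbT.
  have [g gU] := compact_operator_ultra_cvg UU cG zB.
  have yU : y @ U --> u + g.
    have : (fun n => u + (l n)^-1 *: S s0 (z n)) @ U --> u + (1 : R) *: g.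
      by apply: cvgD; [exact: cvg_cst|exact: cvgZ].
    rewrite scale1r; apply: cvg_trans; apply: near_eq_cvg.
    apply: filterS UB => n /= yn; rewrite [RHS]yE; congr (_ + _ *: S s0 _).
    by rewrite /z yn.
  pose w := u + g.
  have Cw : C w by apply: (closed_cvg C (cone_closed hC) _ _ yU); near=> n.
  have wE : w = u + S s0 w.
    rewrite /w; congr (_ + _); apply: (cvg_unique _ gU) => //.
    have : (fun n => S s0 (y n)) @ U --> S s0 w by apply: continuous_cvg => //; exact: ctG.
    apply: cvg_trans; apply: near_eq_cvg.
    by apply: filterS UB => n /= yn; rewrite /z yn.
  have sumE n : \sum_(0 <= k < n) (u' (iter k (S s0) u) : R) = u' w - u' (iter n (S s0) w).
    rewrite (@telescope_sumr_eq _ 0 n (fun k => - (u' (iter k (S s0) w) : R)))//.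
      by rewrite opprK addrC.
    move=> k _; rewrite opprK addrC iterSr -linearB -iter_linearB {1}wE.
    by rewrite addrK.
  apply: cvg_series_cvg_0.
  apply: nondecreasing_is_cvgn.
    apply: nondecreasing_series => k _ _; apply: u'_ge0; exact: iter_pos.
  exists (u' w) => _ [n _ <-]; rewrite /series/= sumE gerBl.
  by apply: u'_ge0; exact: iter_pos.
pose w n := `|y n|^-1 *: y n.
have wB n : `|w n| <= 1.
  rewrite /w normrZ normfV normr_id; have [->|y0] := eqVneq `|y n| 0; first by rewrite mulr0.
  by rewrite mulVf.
have big B : U [set n | B < `|y n|].
  have [UB|] := in_ultra_setVsetC [set n | `|y n| <= B] UU.
    by case: unb; exists B.
  by apply: filterS => n /= /negP; rewrite ltNge.
have small : (fun n => `|y n|^-1 *: u) @ U --> (0 : X).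
  rewrite -(scale0r u); apply: cvgZr_tmp.
  apply/cvgr0Pnorm_lt => e e0; apply: filterS (big e^-1) => n /= yn.
  have y0 : 0 < `|y n| by apply: lt_trans yn; rewrite invr_gt0.
  by rewrite gtr0_norm ?invr_gt0// -[e]invrK ltf_pV2 ?posrE// invr_gt0.
have [v vU] := compact_operator_ultra_cvg UU cG wB.
have wU : w @ U --> v.
  have -> : w = (fun n => `|y n|^-1 *: u + (l n)^-1 *: S s0 (w n)).
    apply/funext => n; rewrite /w {2}(yE n) linearZ_LR.
    module_eq R X; ring.
  rewrite -[X in _ --> X]add0r; apply: cvgD => //.
  by rewrite -[X in _ --> X]scale1r; exact: cvgZ.
exists v; split.
- apply: (closed_cvg C (cone_closed hC) _ _ wU); near=> n.
  by apply: (cone_scale hC) => //; rewrite invr_ge0.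
- rewrite -normr_eq0.
  have nU : (fun n => `|w n|) @ U --> `|v| by exact: cvg_norm.
  have n1 : (fun n => `|w n|) @ U --> (1 : R).
    have : (fun=> 1 : R) @ U --> (1 : R) by exact: cvg_cst.
    apply: cvg_trans; apply: near_eq_cvg; apply: filterS (big 0) => n /= y0.
    by rewrite /w normrZ normfV normr_id mulVf// gt_eqF.
  by rewrite (cvg_unique _ nU n1)// oner_eq0.
- have : (fun n => S s0 (w n)) @ U --> S s0 v by apply: continuous_cvg => //; exact: ctG.
  by move=> h; apply: (cvg_unique _ h vU).
Unshelve. all: by end_near. Qed.

(** The average of the orbit of a fixed vector of [S s0] over the grid of step
    [s0 / 2^n] is fixed by the operators of this grid and by [S s0], so that the
    averages converge by compactness. The limit is not 0, because [u'] is
    bounded below on the orbit. *)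
Lemma semigroup_fixed_vector : exists v, [/\ C v, v != 0 & forall t, 0 <= t -> S t v = v].
Proof.
have [v [Cv v0 Gv]] := krein_rutman.
pose tau n := s0 * 2^-1 ^+ n.
have tau_gt0 n : 0 < tau n by rewrite mulr_gt0// exprn_gt0.
have kt_ge0 n k : 0 <= k%:R * tau n by rewrite mulr_ge0// ltW.
have tauE n : (2 ^ n)%N%:R * tau n = s0.
  by rewrite /tau natrX mulrCA -exprMn mulfV// expr1n mulr1.
have [M [M1 MS]] := semigroup_bounded_on hS (ltW s0_gt0).
have M0 : 0 < M := lt_le_trans ltr01 M1.
have [N [N0 NP]] := compact_strictly_positive_bound hC cG ctG posG hu'
  (ltac:(by rewrite invr_gt0) : 0 < 2^-1 :> R).
(* vectors of the orbit are fixed by [S s0]: for them the bound above reads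
   [`|x| <= 2 * N * u' x] *)
pose a := `|v| / (2 * N * M).
have a0 : 0 < a by rewrite divr_gt0 ?normr_gt0// !mulr_gt0.
have orbit_low t : 0 <= t <= s0 -> a <= u' (S t v).
  move=> /andP[t0 ts].
  have Gt : S s0 (S t v) = S t v by rewrite (semigroup_comm hS) ?(ltW s0_gt0)// Gv.
  have := NP (S t v) (posS' t0 Cv); rewrite Gt => h.
  have st0 : 0 <= s0 - t by rewrite subr_ge0.
  have : `|v| <= M * `|S t v|.
    rewrite -{1}Gv -{1}(subrK t s0) (semigroup_add hS)//; apply: MS.
    by rewrite st0/= gerBl.
  rewrite /a ler_pdivrMr ?mulr_gt0// => h2; apply: le_trans h2 _.
  have -> : u' (S t v) * (2 * N * M) = M * (2 * N * u' (S t v)) by ring.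
  rewrite ler_pM2l//; lra.
pose w n := 2^-1 ^+ n *: \sum_(0 <= k < 2 ^ n) S (k%:R * tau n) v.
have w_tau n : S (tau n) (w n) = w n.
  rewrite /w linearZ_LR linear_sum; congr (_ *: _).
  have shift k : S (tau n) (S (k%:R * tau n) v) = S (k.+1%:R * tau n) v.
    rewrite -(semigroup_add hS (ltW (tau_gt0 n)) (kt_ge0 n k)).
    by rewrite -natr1 mulrDl mul1r addrC.
  under eq_bigr do rewrite shift.
  apply/eqP; rewrite -subr_eq0 -sumrB telescope_sumr//.
  by rewrite tauE mul0r (semigroup_0 hS) Gv subrr.
have w_grid n m k : (m <= n)%N -> S (k%:R * tau m) (w n) = w n.
  move=> mn; have -> : k%:R * tau m = (k * 2 ^ (n - m))%N%:R * tau n.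
    rewrite /tau -{2}(subnKC mn) exprD natrM natrX.
    have -> : 2 ^+ (n - m) = (2^-1 ^+ (n - m))^-1 :> R by rewrite exprVn invrK.
    by field; rewrite gt_eqF// exprn_gt0.
  rewrite (semigroup_iter hS _ _ (ltW (tau_gt0 n))).
  by elim: (k * _)%N => //= j ->; exact: w_tau.
have w_norm n : `|w n| <= M * `|v|.
  rewrite /w normrZ ger0_norm ?exprn_ge0// exprVn ler_pdivrMl ?exprn_gt0//.
  apply: le_trans (ler_norm_sum _ _ _) _.
  have -> : 2 ^+ n * (M * `|v|) = \sum_(0 <= k < 2 ^ n) (M * `|v|).
    by rewrite sumr_const_nat subn0 -[RHS]mulr_natl natrX.
  rewrite big_nat [leRHS]big_nat; apply: ler_sum => k /andP[_ kn]; apply: MS.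
  rewrite kt_ge0/= -(tauE n) ler_pM2r//.
  by rewrite ler_nat ltnW.
have w_low n : a <= u' (w n).
  rewrite /w linearZ_LR linear_sum -[_ *: _]/(_ * _) exprVn ler_pdivlMl ?exprn_gt0//.
  have -> : 2 ^+ n * a = \sum_(0 <= k < 2 ^ n) a.
    by rewrite sumr_const_nat subn0 -[RHS]mulr_natl natrX.
  rewrite big_nat [leRHS]big_nat; apply: ler_sum => k /andP[_ kn].
  apply: orbit_low; rewrite kt_ge0/= -(tauE n) ler_pM2r//.
  by rewrite ler_nat ltnW.
have w_pos n : C (w n).
  apply: (cone_scale hC); first by rewrite exprn_ge0.
  apply: big_ind; [exact: cone0 hC|exact: cone_add hC|] => k _.
  by apply: posS'.
have w_s0 n : S s0 (w n) = w n by rewrite -(tauE n) w_grid.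
have [U [UU Uoo]] := ultra_eventually.
have [z zU0] := compact_operator_ultra_cvg UU cG w_norm.
have zU : w @ U --> z by move: zU0; rewrite (funext w_s0).
have Cz : C z by apply: (closed_cvg C (cone_closed hC) _ _ zU); near=> n.
exists z; split=> //.
  have uU : (fun n => u' (w n)) @ U --> u' z.
    by apply: continuous_cvg => //; exact: u'_cont.
  have az : a <= u' z.
    apply: (@closed_cvg _ R^o U _ _ (fun r : R => a <= r) _ _ _ uU); first exact: closed_ge.
    by near=> n.
  by apply: contraTneq (lt_le_trans a0 az) => ->; rewrite linear0 ltxx.
have z_grid m k : S (k%:R * tau m) z = z.
  have SU : (fun n => S (k%:R * tau m) (w n)) @ U --> S (k%:R * tau m) z.
    apply: continuous_cvg => //; apply: (semigroup_bounded hS).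
    by rewrite mulr_ge0// ltW.
  apply: (cvg_unique _ SU) => //; apply: cvg_trans zU; apply: near_eq_cvg.
  apply: Uoo; exists m => // n /= mn; by rewrite w_grid.
move=> t t0.
have tau_cvg : tau @ \oo --> (0 : R).
  rewrite -[X in _ --> X](mulr0 s0); apply: cvgMr.
  by apply: cvg_expr; rewrite ger0_norm//; lra.
have [J [J_ge J_cvg]] := grid_above t0 tau_gt0 tau_cvg.
have St := semigroup_cvg_above hS (z := z) t0 J_ge J_cvg.
apply: (cvg_unique _ St) => //.
by rewrite (_ : (fun n => _) = (fun=> z)); [exact: cvg_cst|apply/funext => n].
Unshelve. all: by end_near. Qed.

(** The orbit of [u] outgrows [rho ^+ n] for some [rho] close to 1 that is not
    the modulus of an eigenvalue, so its norms at consecutive multiples of [s0]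
    are comparable. With [d] small, the second term of
    [compact_strictly_positive_bound] is then absorbed, and [u' (S t u)] is
    comparable to [`|S t u|]. *)
Lemma pairing_lower_bound e : 0 < e -> exists c, 0 < c /\
  \forall t \near +oo, c * expR (- (t * e)) <= u' (S t u).
Proof.
move=> e0.
have q1 : 0 < expR (- (s0 * e)) :> R by rewrite expR_gt0.
have q2 : expR (- (s0 * e)) < 1 by rewrite -expR0 ltr_expR oppr_lt0 mulr_gt0.
have [rho [/andP[rho1 rho2] plane]] := exists_radius_without_eigenplane cG ctG q1 q2.
have rho0 : 0 < rho := lt_trans q1 rho1.
have [B [B0 BP]] := continuous_linear_bound u'_cont.
have unb K : exists n, K < `|iter n (S s0) u| / rho ^+ n.
  apply: contrapT => no; apply: orbit_not_vanishing.
  have le n : `|iter n (S s0) u| <= K * rho ^+ n.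
    rewrite -ler_pdivrMr ?exprn_gt0// leNgt; apply/negP => lt; apply: no.
    by exists n.
  apply/cvgr0Pnorm_le => d d0.
  have : B * K * rho ^+ n @[n --> \oo] --> (0 : R).
    by apply: cvg_geometric; rewrite ger0_norm// ltW.
  move=> /cvgr0Pnorm_le/(_ d d0); apply: filterS => n.
  apply: le_trans; apply: le_trans (BP _) _; apply: le_trans (ler_norm _).
  by rewrite -mulrA ler_pM2l.
have [c [c0 [n0 _ reg]]] := outgrowing_orbit_regular cG ctG rho0 plane unb.
have [M [M1 MS]] := semigroup_bounded_on hS (ltW s0_gt0).
have M0 : 0 < M := lt_le_trans ltr01 M1.
(* [`|x| <= (M / c) ^+ 2 * `|S t u|] for the vector [x] below *)
pose d := c ^+ 2 / (2 * M ^+ 2).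
have d0 : 0 < d by rewrite divr_gt0 ?mulr_gt0// exprn_gt0.
have [N [N0 NP]] := compact_strictly_positive_bound hC cG ctG posG hu' d0.
exists (expR (- (s0 * e)) / (2 * N * M)).
split; first by rewrite divr_gt0// !mulr_gt0.
exists ((n0 + 1)%N%:R * s0); split; first exact: num_real.
move=> t ht.
have t0 : 0 <= t by apply: le_trans (ltW ht); rewrite mulr_ge0// ltW.
pose n := Num.truncn (t / s0).
have ts0 : 0 <= t / s0 by rewrite divr_ge0// ltW.
have /andP[k1 k2] := truncn_itv ts0; rewrite -/n in k1 k2.
have n_gt : (n0 < n)%N.
  rewrite -ltnS -(ltr_nat R); apply: lt_trans k2.
  by rewrite ltr_pdivlMr// -addn1.
pose s := t - n%:R * s0.
have s_ge0 : 0 <= s by rewrite subr_ge0 -ler_pdivlMr.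
have s_le : s <= s0.
  by rewrite lerBlDr -[X in X + _]mul1r -mulrDl nat1r -ler_pdivrMr// ltW.
have Ssn k : S (s + k%:R * s0) u = S s (iter k (S s0) u).
  by rewrite (semigroup_add hS)// ?mulr_ge0 ?(ltW s0_gt0)// semigroup_iter ?(ltW s0_gt0).
have tE : t = s + n%:R * s0 by rewrite subrK.
have n1 : n = n.-1.+1 by rewrite prednK// (leq_ltn_trans _ n_gt).
(* one period before [t], so that [S s0 x = S t u] *)
pose x := S (s + n.-1%:R * s0) u.
have Cx : C x by apply: posS' => //; rewrite addr_ge0// mulr_ge0// ltW.
have Gx : S s0 x = S t u.
  have xn : 0 <= s + n.-1%:R * s0 by rewrite addr_ge0// mulr_ge0// ltW.
  rewrite /x -(semigroup_add hS (ltW s0_gt0) xn).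
  by rewrite tE n1 -natr1 mulrDl mul1r addrCA [s0 + _]addrC.
have low : `|iter n.+1 (S s0) u| <= M * `|S t u|.
  have -> : iter n.+1 (S s0) u = S (s0 - s) (S t u).
    have st : 0 <= s0 - s by rewrite subr_ge0.
    by rewrite tE Ssn -(semigroup_add hS st s_ge0) subrK.
  by apply: MS; rewrite subr_ge0 s_le/= gerBl.
have xle : `|x| <= M * `|iter n.-1 (S s0) u|.
  by rewrite /x Ssn; apply: MS; rewrite s_ge0.
have [_ reg1] := reg n.-1 ltac:(by rewrite /= -ltnS -n1).
have [rn reg2] := reg n (ltnW n_gt).
rewrite -n1 in reg1.
have rn1 : rho ^+ n.+1 <= `|iter n.+1 (S s0) u|.
  by have [] := reg n.+1 (leqW (ltnW n_gt)).
have xle2 : d * `|x| <= 2^-1 * `|S t u|.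
  have h : c ^+ 2 * `|x| <= M ^+ 2 * `|S t u|.
    apply: le_trans (_ : c ^+ 2 * (M * `|iter n.-1 (S s0) u|) <= _).
      by rewrite ler_wpM2l// sqr_ge0.
    have -> : c ^+ 2 * (M * `|iter n.-1 (S s0) u|) = M * (c * (c * `|iter n.-1 (S s0) u|)) by ring.
    rewrite expr2 -mulrA ler_pM2l//; apply: le_trans low.
    by apply: le_trans reg2; rewrite ler_pM2l.
  rewrite /d mulrAC ler_pdivrMr ?mulr_gt0 ?exprn_gt0//.
  apply: le_trans h _; rewrite le_eqVlt; apply/orP; left; apply/eqP.
  by field.
have := NP x Cx; rewrite Gx => main.
have fin : `|S t u| <= 2 * N * u' (S t u) by lra.
rewrite mulrAC ler_pdivrMr ?mulr_gt0//.
apply: le_trans (_ : M * `|S t u| <= _); last first.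
  have -> : u' (S t u) * (2 * N * M) = M * (2 * N * u' (S t u)) by ring.
  by rewrite ler_pM2l.
apply: le_trans low; apply: le_trans rn1.
apply: le_trans (_ : expR (- (s0 * e)) ^+ n.+1 <= _); last first.
  by rewrite lerXn2r ?nnegrE ?expR_ge0 ?(ltW rho0)// ltW.
rewrite exprS ler_wpM2l ?expR_ge0// -expRM_natl ler_expR.
rewrite mulrN lerN2 mulrA ler_wpM2r ?(ltW e0)//.
by rewrite -ler_pdivlMr.
Qed.

End NormalisedSemigroup.

(** * Rescaling, eigenvectors and spectral bound *)

Lemma compact_operator_scale_comp (R : realType) (X Y Z : completeNormedModType R)
    (G : {linear Y -> Z}) (f : {linear X -> Y}) (H : {linear X -> Z}) (c M : R) :
  compact_operator G -> (forall x, `|f x| <= M * `|x|) ->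
  (forall x, H x = c *: G (f x)) -> compact_operator H.
Proof.
move=> [K GK [cK clK]] fM HE.
pose b := `|M| + 1; have b0 : 0 < b by rewrite ltr_wpDl.
have cbK : compact ((fun y => (c * b) *: y) @` K).
  apply: continuous_compact => //; apply: continuous_subspaceT => y.
  exact: cvgZr.
exists ((fun y => (c * b) *: y) @` K); last first.
  split=> //; apply: compact_closed => //; exact: norm_hausdorff.
move=> _ [x /= x1 <-]; exists (G (b^-1 *: f x)).
  apply: GK; exists (b^-1 *: f x) => //=.
  rewrite normrZ gtr0_norm ?invr_gt0// ler_pdivrMl// mulr1.
  apply: le_trans (fM x) _; apply: le_trans (ler_norm _) _.
  rewrite normrM normr_id; apply: le_trans (_ : `|M| * 1 <= _).
    by rewrite ler_wpM2l.
  by rewrite mulr1 lerDl.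
by rewrite HE linearZ_LR scalerA mulfK ?gt_eqF.
Qed.

Section Rescaling.
Context {R : realType} {X : completeNormedModType R} (T : R -> {linear X -> X}).
Hypothesis hT : C0_semigroup T.
Variable w : R.

Definition rescaled (t : R) : {linear X -> X} := expR (- (t * w)) \*: T t.

Lemma rescaledE t x : T t x = expR (t * w) *: rescaled t x.
Proof. by rewrite /rescaled/= scalerA expRN mulfV ?scale1r// gt_eqF// expR_gt0. Qed.

Lemma rescaled_C0 : C0_semigroup rescaled.
Proof.
split.
- move=> t t0 x; rewrite /rescaled; apply: cvgZr; exact: (semigroup_bounded hT t0).
- by move=> x; rewrite /rescaled/= mul0r oppr0 expR0 scale1r (semigroup_0 hT).
- move=> s t s0 t0 x; rewrite /rescaled/= (semigroup_add hT)// linearZ_LR scalerA.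
  by rewrite mulrDl opprD expRD.
- move=> x; rewrite /rescaled -[X in _ --> X]scale1r; apply: cvgZ; last first.
    exact: (semigroup_strongly_continuous hT).
  have [+ _] := cvg_cs w 0; apply: cvg_trans; apply: near_eq_cvg; near=> t.
  by rewrite mulr0 cos0 mulr1 mulrN.
Unshelve. all: by end_near. Qed.

Lemma rescaled_growth_rate e : growth_rate rescaled e <-> growth_rate T (w + e).
Proof.
split=> -[M [M1 MP]]; exists M; split=> // t t0 x.
  rewrite rescaledE normrZ gtr0_norm ?expR_gt0//.
  apply: le_trans (ler_wpM2l (expR_ge0 _) (MP t t0 x)) _.
  by rewrite mulrDr expRD le_eqVlt; apply/orP; left; apply/eqP; ring.
rewrite /rescaled/= normrZ gtr0_norm ?expR_gt0//.
apply: le_trans (ler_wpM2l (expR_ge0 _) (MP t t0 x)) _.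
rewrite mulrDr expRD le_eqVlt expRN; apply/orP; left; apply/eqP; field.
by rewrite gt_eqF// expR_gt0.
Qed.

End Rescaling.

(** The generator maps [v] to [r v], so a resolvent at [r] would map 0 both to 0
    and to [(v, 0)]. *)
Lemma exponential_orbit_spectrum (R : realType) (X : completeNormedModType R)
    (T : R -> {linear X -> X}) (r : R) (v : X) : v != 0 ->
  (forall t, 0 <= t -> T t v = expR (t * r) *: v) ->
  spectrum (complexified_operator (generator T)) (r%:C)%C.
Proof.
move=> v0 Tv [S [_ _ Sl]].
have gen x y : h^-1 *: (T h x - x) @[h --> (0:R)^'+] --> y ->
    udom (generator T) x /\ uop (generator T) x = y.
  by move=> xy; split; [apply/cvg_ex; exists y|exact: cvg_lim xy].
have [d0 e0] : udom (generator T) 0 /\ uop (generator T) 0 = 0.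
  apply: gen; rewrite (_ : (fun h => _) = (fun=> 0)); first exact: cvg_cst.
  by apply/funext => h; rewrite linear0 subrr scaler0.
have [dv ev] : udom (generator T) v /\ uop (generator T) v = r *: v.
  apply: gen.
  have vr : (h^-1 * (expR (h * r) * cos (h * 0) - 1)) *: v @[h --> (0:R)^'+] --> r *: v.
    exact: (cvgZr_tmp (@expR_cos_right R r 0)).
  apply: cvg_trans vr; apply: near_eq_cvg; near=> h.
  rewrite Tv; last by near: h; exact: nbhs_right_ge.
  by rewrite mulr0 cos0 mulr1 -scalerA scalerBl scale1r.
have S1 := Sl (v, 0) (conj dv d0); have S2 := Sl (0, 0) (conj d0 d0).
move: S1 S2.
rewrite (congr2 pair ev e0 : uop (complexified_operator (generator T)) (v, 0) = _).
rewrite (congr2 pair e0 e0 : uop (complexified_operator (generator T)) (0, 0) = _).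
have -> : (r%:C)%C *: ((v, 0) : complexification X) - (r *: v, 0) = (0, 0).
  by congr pair; rewrite /=; module_eq R X; ring.
have -> : (r%:C)%C *: ((0, 0) : complexification X) - (0, 0) = (0, 0).
  by congr pair; rewrite /=; module_eq R X; ring.
by move=> -> [/eqP]; rewrite (negbTE v0).
Unshelve. all: by end_near. Qed.

Lemma spectral_bound_le_growth_bound (R : realType) (X : completeNormedModType R)
    (T : R -> {linear X -> X}) : C0_semigroup T ->
  (spectral_bound (generator T) <= growth_bound T)%E.
Proof.
move=> hT; apply: ge_ereal_sup => _ [l lS <-]; rewrite leNgt; apply/negP => lt.
apply: lS; have := lt; rewrite growth_boundE => /ereal_inf_lt[_ [w rw <-]].
by rewrite lte_fin; exact: growth_rate_resolvent.
Qed.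

Lemma spectral_bound_ge (R : realType) (X : completeNormedModType R)
    (T : R -> {linear X -> X}) (r : R) :
  spectrum (complexified_operator (generator T)) (r%:C)%C ->
  (r%:E <= spectral_bound (generator T))%E.
Proof. by move=> rS; apply: ereal_sup_ubound; exists (r%:C)%C. Qed.

(** * Exponential growth of the pairing *)

Lemma eventually_compact_gt0 (R : realType) (X : completeNormedModType R)
    (T : R -> {linear X -> X}) : C0_semigroup T -> eventually_compact T ->
  exists s, 0 < s /\ compact_operator (T s).
Proof.
move=> hT [t [t0 ct]]; exists (t + 1); split; first by rewrite ltr_wpDl.
have [M [_ MP]] := continuous_linear_bound (semigroup_bounded hT ler01).
apply: (compact_operator_scale_comp (c := 1) ct MP) => x.
by rewrite scale1r (semigroup_add hT).
Qed.

Lemma lne_div_EFin (R : realType) (y t : R) : 0 < y -> 0 < t ->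
  (lne y%:E / t%:E)%E = (ln y / t)%:E.
Proof. by move=> y0 t0; rewrite lne_EFin// inver gt_eqF. Qed.

(** The constants contribute [ln K / t], which tends to 0. *)
Lemma ln_div_cvg (R : realType) (f : R -> R) (r : R) :
  (forall e, 0 < e -> exists K, 0 < K /\
    \forall t \near +oo, f t <= K * expR (t * (r + e))) ->
  (forall e, 0 < e -> exists K, 0 < K /\
    \forall t \near +oo, K * expR (t * (r - e)) <= f t) ->
  (lne (f t)%:E / t%:E)%E @[t --> +oo] --> r%:E.
Proof.
move=> up low.
have [K0 [K00 f0]] := low 1 ltr01.
have fpos : \forall t \near +oo, 0 < f t.
  by apply: filterS f0 => t; apply: lt_le_trans; rewrite mulr_gt0// expR_gt0.
have real_cvg : ln (f t) / t @[t --> +oo] --> r.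
  apply/cvgrPdist_le => e e0.
  have e2 : 0 < e / 2 by rewrite divr_gt0.
  have [K1 [K10 f1]] := up _ e2; have [K2 [K20 f2]] := low _ e2.
  near=> t.
  have t0 : 0 < t by near: t; exact: nbhs_pinfty_gt (num_real _).
  have ft : 0 < f t by near: t.
  have h1 : f t <= K1 * expR (t * (r + e / 2)) by near: t.
  have h2 : K2 * expR (t * (r - e / 2)) <= f t by near: t.
  have b1 : `|ln K1| / (e / 2) < t by near: t; exact: nbhs_pinfty_gt (num_real _).
  have b2 : `|ln K2| / (e / 2) < t by near: t; exact: nbhs_pinfty_gt (num_real _).
  rewrite ltr_pdivrMr// in b1; rewrite ltr_pdivrMr// in b2.
  have l1 : ln (f t) <= ln K1 + t * (r + e / 2).
    rewrite -[X in _ + X]expRK -lnM ?posrE ?expR_gt0// ler_ln ?posrE//.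
    by rewrite mulr_gt0// expR_gt0.
  have l2 : ln K2 + t * (r - e / 2) <= ln (f t).
    rewrite -[X in _ + X]expRK -lnM ?posrE ?expR_gt0// ler_ln ?posrE//.
    by rewrite mulr_gt0// expR_gt0.
  have n1 := ler_norm (ln K1); have n2 := ler_norm (- ln K2); rewrite normrN in n2.
  rewrite ler_distlC; apply/andP; split.
    by rewrite ler_pdivlMr//; move: l2; rewrite mulrBr; lra.
  by rewrite ler_pdivrMr//; move: l1; rewrite mulrDr; lra.
have ecvg : (ln (f t) / t)%:E @[t --> +oo] --> r%:E by apply/fine_cvgP; split; [exact: nearW|].
apply: cvg_trans ecvg; apply: near_eq_cvg; near=> t.
have ft : 0 < f t by near: t.
have t0 : 0 < t by near: t; exact: nbhs_pinfty_gt (num_real _).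
by rewrite lne_div_EFin.
Unshelve. all: by end_near. Qed.

Lemma ln_div_cvgNy (R : realType) (f : R -> R) : (forall t, 0 <= t -> 0 <= f t) ->
  (forall w, exists K, 0 < K /\ \forall t \near +oo, f t <= K * expR (t * w)) ->
  (lne (f t)%:E / t%:E)%E @[t --> +oo] --> -oo%E.
Proof.
move=> f0 up; apply/cvgeNyPler => A _.
have [K [K0 fK]] := up (A - 1).
near=> t.
have t0 : 0 < t by near: t; exact: nbhs_pinfty_gt (num_real _).
have := f0 t (ltW t0); rewrite le_eqVlt => /orP[/eqP <-|ft].
  (* the logarithm of 0 is -oo, and stays so when divided by [t] *)
  by rewrite le0_lneNy// inver gt_eqF// mulNyr gtr0_sg ?invr_gt0// mul1e leNye.
rewrite lne_div_EFin// lee_fin ler_pdivrMr//.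
have h1 : f t <= K * expR (t * (A - 1)) by near: t.
have b1 : ln K < t by near: t; exact: nbhs_pinfty_gt (num_real _).
have l1 : ln (f t) <= ln K + t * (A - 1).
  rewrite -[X in _ + X]expRK -lnM ?posrE ?expR_gt0// ler_ln ?posrE//.
  by rewrite mulr_gt0// expR_gt0.
by move: l1; rewrite mulrBr mulr1 [t * A]mulrC; lra.
Unshelve. all: by end_near. Qed.

Theorem theorem7p4 (R : realType) (X : completeNormedModType R) (C : set X)
    (hC : ordered_banach_cone C)
    (T : R -> {linear X -> X})
    (hT : C0_semigroup T)
    (hpos : positive_semigroup C T)
    (hcompact : eventually_compact T)
    (u : X) (hu : almost_interior C u)
    (u' : {linear X -> R^o}) (hu' : strictly_positive C u') :
  spectral_bound (generator T) = growth_bound T /\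
  ((lne (u' (T t u))%:E / t%:E)%E @[t --> +oo] --> growth_bound T).
Proof.
have [s [s0 cK]] := eventually_compact_gt0 hT hcompact.
have sle := spectral_bound_le_growth_bound hT.
have [B [B0 BP]] := continuous_linear_bound hu'.1.1.
have u1 : 0 < `|u| + 1 by rewrite ltr_wpDl.
have pairing_up w : growth_rate T w -> exists K, 0 < K /\
    \forall t \near +oo, u' (T t u) <= K * expR (t * w).
  move=> [M [M1 MP]]; have M0 : 0 < M := lt_le_trans ltr01 M1.
  exists (B * M * (`|u| + 1)); split; first by rewrite !mulr_gt0.
  near=> t; have t0 : 0 <= t by near: t; exact: nbhs_pinfty_ge (num_real _).
  apply: le_trans (ler_norm _) _; apply: le_trans (BP _) _.
  rewrite -!mulrA ler_pM2l//; apply: le_trans (MP t t0 u) _.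
  rewrite -mulrA ler_pM2l// mulrC ler_wpM2r ?expR_ge0//.
  by rewrite lerDl.
have := growth_bound_ltNyr hT; have gt_rate := @growth_rate_gt _ _ T.
have le_rate := @growth_bound_le _ _ T.
case: (growth_bound T) sle gt_rate le_rate => [r||] sle gt_rate le_rate // _.
- pose S := rescaled T r; have hS := rescaled_C0 hT r.
  have posS : positive_semigroup C S.
    move=> t t0 _ [x Cx <-]; apply: (cone_scale hC); first exact: expR_ge0.
    by apply: (hpos t t0); exists x.
  have cS : compact_operator (S s).
    apply: (compact_operator_scale_comp (f := @idfun X) (c := expR (- (s * r)))
      (M := 1) cK) => // x.
    by rewrite mul1r.
  have up e : 0 < e -> growth_rate S e.
    by move=> e0; apply/rescaled_growth_rate; apply: gt_rate; rewrite lte_fin ltrDl.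
  have low e : 0 < e -> ~ growth_rate S (- e).
    by move=> e0 /rescaled_growth_rate/le_rate; rewrite lee_fin lerDl oppr_ge0 leNgt e0.
  split.
    have [v [Cv v0 Sv]] := semigroup_fixed_vector hC hS posS s0 cS up low hu hu'.
    apply/eqP; rewrite eq_le sle/=; apply: spectral_bound_ge.
    apply: exponential_orbit_spectrum v0 _ => t t0.
    by rewrite (rescaledE T r) -/S Sv.
  apply: ln_div_cvg => e e0.
    by apply: pairing_up; apply: gt_rate; rewrite lte_fin ltrDl.
  have [c [c0 cP]] := pairing_lower_bound hC hS posS s0 cS low hu hu' e0.
  exists c; split=> //; apply: filterS cP => t.
  have -> : u' (T t u) = expR (t * r) * u' (S t u) :> R.
    by rewrite (rescaledE T r) linearZ.
  move=> h; apply: le_trans _ (ler_wpM2l (expR_ge0 (t * r)) h).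
  by rewrite mulrBr expRD mulrCA.
- have rate w : growth_rate T w by apply: gt_rate; exact: ltNyr.
  split; first by apply/eqP; rewrite -leeNy_eq.
  apply: ln_div_cvgNy => [t t0|w]; last exact: pairing_up.
  by apply: hu'.1.2; apply: (hpos t t0); exists u => //; exact: hu.1.
Unshelve. all: by end_near. Qed.
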